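(* Let $\mu(s)$ be a rational function over $\mathbb{C}$ with a finite non-zero limit $\mu_0=\lim_{s\to\infty}\mu(s)$, and suppose that the identity $$ {}_2F_1\!\left(\tfrac12,\tfrac14;\tfrac54;\,z\right)=\left(\frac{\mu(1/z)}{\mu_0}\right)^{-1/2}{}_2F_1\!\left(\tfrac12,\tfrac14;\tfrac54;\,\frac{z}{\mu(1/z)^2}\right) $$ holds. Then there is a non-zero isogeny $\phi:E_1\to E_1$ of the elliptic curve $E_1:y^2=x^3-x$ that transforms the $x$-coordinate as $x\mapsto x\,\mu(x^2)$.
   Context: $E_1$ is the elliptic curve over $\mathbb{C}$ given by $y^2=x^3-x$, with the point at infinity as the neutral element. An isogeny here is an isogeny endomorphism: an algebraic map $E_1\to E_1$ respecting the addition law (equivalently, fixing the point at infinity). ''Transforms the $x$-coordinate as $x\mapsto x\,\mu(x^2)$'' means that the $x$-component of $\phi(x,y)$ is the function $x\,\mu(x^2)$. ${}_2F_1(A,B;C;z)$ is the Gauss hypergeometric function. The identity is one of analytic functions in a neighbourhood of $z=0$, where the power factor is the branch with value $1$ at $z=0$. *)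

(* Defs.v *)
From HB Require Import structures.
From mathcomp Require Import all_boot all_order all_algebra.
From mathcomp Require Import all_classical all_reals all_analysis.
From mathcomp Require Import fraction generic_quotient complex ring.
(* The notations of mpoly clash with those of mathcomp-analysis. *)
From mathcomp Require Import -(notations) mpoly.

Set Implicit Arguments.
Unset Strict Implicit.
Unset Printing Implicit Defensive.

Import Order.TTheory GRing.Theory Num.Theory.
Import numFieldNormedType.Exports.

Local Open Scope classical_set_scope.
Local Open Scope ring_scope.

(* Topology on R[i] given by the complex modulus. *)
HB.instance Definition _ (R : realType) := GRing.ComAlgebra.copy R[i] R[i]^o.
HB.instance Definition _ (R : realType) := Vector.copy R[i] R[i]^o.
HB.instance Definition _ (R : realType) := NormedModule.copy R[i] R[i]^o.

Section Hypergeometric.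
Variable C : numClosedFieldType.

Definition pochhammer (a : C) (n : nat) : C := \prod_(i < n) (a + i%:R).

Definition hyp2F1_term (a b c z : C) (n : nat) : C :=
  pochhammer a n * pochhammer b n / (pochhammer c n * n`!%:R) * z ^+ n.

(* Only meaningful where the series converges, in particular for `|z| < 1. *)
Definition hyp2F1 (a b c z : C) : C := limn (series (hyp2F1_term a b c z)).

(* The filter s --> oo in the complex plane.  The bound M must be real: a
   non-real M is not comparable with any modulus. *)
Definition cinfty : set_system C :=
  [set A | exists M : C, M \is Num.real /\ forall s, M < `|s| -> A s].

Global Instance cinfty_proper_filter : ProperFilter cinfty.
Proof.
split=> [[M [Mr]] /(_ (`|M| + 1))|].
  apply; rewrite ger0_norm ?addr_ge0 //.
  by rewrite (le_lt_trans (real_ler_norm Mr)) // ltrDl ltr01.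
split; first by exists 0; split=> //; exact: real0.
- move=> A B [M [Mr hA]] [N [Nr hB]]; exists (`|M| + `|N|); split.
    by rewrite realD ?normr_real.
  move=> s hs; split; [apply: hA|apply: hB]; apply: le_lt_trans hs.
    by rewrite (le_trans (real_ler_norm Mr)) // lerDl.
  by rewrite (le_trans (real_ler_norm Nr)) // lerDr.
- by move=> A B AB [M [Mr hA]]; exists M; split=> // s /hA /AB.
Qed.

End Hypergeometric.
Arguments cinfty {C}.

(* The principal branch of w ^ (-1/2): sqrtc has non-negative real part, so
   this is analytic near w = 1, with value 1 there.  (The generic sqrtC has
   non-negative imaginary part instead and is discontinuous at 1.) *)
Definition powNhalf (R : realType) (w : R[i]) : R[i] := (sqrtc w)^-1.

Section RationalFunctions.
Variable K : fieldType.
Implicit Types f : {fraction {poly K}}.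

(* Numerator and denominator in lowest terms; repr f need not be reduced. *)
Definition ratnum f : {poly K} :=
  (repr f).1 %/ gcdp (repr f).1 (repr f).2.
Definition ratden f : {poly K} :=
  (repr f).2 %/ gcdp (repr f).1 (repr f).2.

Definition ratval f (s : K) : K := (ratnum f).[s] / (ratden f).[s].

Lemma ratden_neq0 f : ratden f != 0.
Proof. by rewrite dvdp_div_eq0 ?dvdp_gcdr // denom_ratioP. Qed.

Lemma coprimep_ratnum_ratden f : coprimep (ratnum f) (ratden f).
Proof. by apply: coprimep_div_gcd; rewrite denom_ratioP orbT. Qed.

Lemma ratnum_ratdenE f :
  f = FracField.tofrac (ratnum f) / FracField.tofrac (ratden f).
Proof.
apply: (canRL (mulfK _)); first by rewrite tofrac_eq0 ratden_neq0.
pose g := gcdp (repr f).1 (repr f).2.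
have g0 : g != 0 by rewrite gcdp_eq0 negb_and denom_ratioP orbT.
have hn : ratnum f * g = (repr f).1 by rewrite divpK ?dvdp_gcdl.
have hd : ratden f * g = (repr f).2 by rewrite divpK ?dvdp_gcdr.
have fE : f * FracField.tofrac (repr f).2 = FracField.tofrac (repr f).1.
  rewrite -{1}[f]reprK; set r := repr f.
  unlock FracField.tofrac; rewrite -[LHS]FracField.pi_mul; apply/eqmodP.
  rewrite /= FracField.equivfE /FracField.mulf.
  by rewrite !numden_Ratio ?oner_eq0 ?mulr1 ?denom_ratioP // mulrC.
apply: (@mulIf _ (FracField.tofrac g)); first by rewrite tofrac_eq0.
by rewrite -mulrA -!tofracM hn hd.
Qed.

End RationalFunctions.

(* The curve y ^ 2 = x ^ 3 - x over a field K. *)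
Section EllipticCurve.
Variable K : fieldType.

Inductive point : Type := Inf | Aff of K & K.

Definition onE1 (P : point) : bool :=
  if P is Aff x y then y ^+ 2 == x ^+ 3 - x else true.

Record E1 : Type := MkE1 { E1val :> point; E1P : onE1 E1val }.

Definition E1_0 : E1 := @MkE1 Inf isT.

(* Third intersection point, reflected in the x-axis, of the curve with the
   line of slope s through (x1, y1) and a point of abscissa x2. *)
Definition chord (x1 y1 x2 s : K) : point :=
  let x3 := s ^+ 2 - x1 - x2 in Aff x3 (s * (x1 - x3) - y1).

Definition padd (P Q : point) : point :=
  match P, Q with
  | Inf, _ => Q
  | _, Inf => P
  | Aff x1 y1, Aff x2 y2 =>
    if x1 != x2 then chord x1 y1 x2 ((y2 - y1) / (x2 - x1))
    else if y1 == - y2 then Inf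
    else chord x1 y1 x2 ((3 * x1 ^+ 2 - 1) / (2 * y1))
  end.

Lemma onE1_chord x1 y1 x2 s : onE1 (Aff x1 y1) ->
  2 * y1 * s + s ^+ 2 * (x2 - x1) = x2 ^+ 2 + x1 * x2 + x1 ^+ 2 - 1 ->
  onE1 (chord x1 y1 x2 s).
Proof.
move=> /eqP h1 key; apply/eqP => /=; set x3 := s ^+ 2 - x1 - x2.
have -> : (s * (x1 - x3) - y1) ^+ 2 =
    y1 ^+ 2 + (x3 - x1) * (2 * y1 * s + s ^+ 2 * (x2 - x1))
    + (x3 - x1) * s ^+ 2 * (x3 - x2) by ring.
rewrite key h1; have -> : s ^+ 2 = x1 + x2 + x3 by rewrite /x3; ring.
by ring.
Qed.

Lemma onE1_padd P Q : onE1 P -> onE1 Q -> onE1 (padd P Q).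
Proof.
case: P => [|x1 y1] //; case: Q => [|x2 y2] // h1 h2 /=.
have [e2|ne] /= := eqVneq x1 x2.
  subst x2.
  case: ifPn => // ny; apply: onE1_chord => //.
  have e : y1 = y2.
    have /eqP : (y1 - y2) * (y1 + y2) = 0.
      by rewrite -subr_sqr (eqP h1) (eqP h2) subrr.
    by rewrite mulf_eq0 subr_eq0 addr_eq0 (negPf ny) orbF => /eqP.
  have y0 : 2 * y1 != 0 by rewrite mulr_natl mulr2n addr_eq0 {2}e.
  by rewrite mulrC divfK //; ring.
apply: onE1_chord => //.
have d0 : x2 - x1 != 0 by rewrite subr_eq0 eq_sym.
set s := _ / _.
have hy2 : y2 = y1 + s * (x2 - x1) by rewrite divfK // addrC subrK.
apply: (mulIf d0); move/eqP: h1 => h1; move/eqP: h2; rewrite hy2 => h2.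
transitivity ((y1 + s * (x2 - x1)) ^+ 2 - y1 ^+ 2); first by ring.
by rewrite h1 h2; ring.
Qed.

Definition E1add (P Q : E1) : E1 := MkE1 (onE1_padd (E1P P) (E1P Q)).

(* Homogeneous coordinates in the projective plane. *)
Definition hcoord (P : point) (i : 'I_3) : K :=
  if P is Aff x y then [:: x; y; 1]`_i else [:: 0; 1; 0]`_i.

(* Around each point, phi is given by three homogeneous polynomials of the same
   degree in the homogeneous coordinates, not all vanishing at that point. *)
Definition algebraic_map (phi : E1 -> E1) : Prop :=
  forall P : E1, exists (d : nat) (F : 'I_3 -> mpoly 3 K),
    [/\ forall i, F i \is ishomog1 d mdeg,
        exists i, meval (hcoord P) (F i) != 0
      & forall Q : E1, (exists i, meval (hcoord Q) (F i) != 0) ->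
          exists2 c : K, c != 0 &
            forall i, meval (hcoord Q) (F i) = c * hcoord (phi Q) i].

Definition isogeny (phi : E1 -> E1) : Prop :=
  algebraic_map phi /\ {morph phi : P Q / E1add P Q}.

Definition nonzero_isogeny (phi : E1 -> E1) : Prop :=
  isogeny phi /\ exists P, phi P <> E1_0.

(* Equality of rational functions on the curve: the x-component of phi is
   x * mu (x ^ 2) wherever the latter is defined.  As ratden is reduced, the
   excluded points are exactly the poles of x * mu (x ^ 2). *)
Definition transforms_x_by (mu : {fraction {poly K}}) (phi : E1 -> E1) : Prop :=
  forall (P : E1) (x y : K), E1val P = Aff x y -> (ratden mu).[x ^+ 2] != 0 ->
    exists y' : K, E1val (phi P) = Aff (x * ratval mu (x ^+ 2)) y'.

End EllipticCurve.

(* Main.v *)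
Require Import Defs.
From HB Require Import structures.
From mathcomp Require Import all_boot all_order all_algebra.
From mathcomp Require Import all_classical all_reals all_analysis.
From mathcomp Require Import fraction complex ring zify.
(* The notations of mpoly clash with those of the topology. *)
From mathcomp Require Import -(notations) mpoly.

Set Implicit Arguments.
Unset Strict Implicit.
Unset Printing Implicit Defensive.

Import Order.TTheory GRing.Theory Num.Theory.
Import numFieldNormedType.Exports.

Local Open Scope classical_set_scope.
Local Open Scope ring_scope.

(** Write F for the hypergeometric function of the theorem and put z = 1 / x^2.
Then 2 x^(-1/2) F(x^(-2)) is the integral of dt / sqrt (t^3 - t) from x to
infinity, so the identity says that the map x |-> X(x) = x mu(x^2) multiplies
this elliptic integral by the constant mu0^(-1/2).  Differentiating removes the
integral: X satisfies

  mu0 (x^3 - x) X'(x)^2 = X(x)^3 - X(x),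

hence (x, y) |-> (X(x), c y X'(x)) with c^2 = mu0 maps the curve to itself.

The differential equation is obtained without differentiating a power series.
If f_n is the n-th partial sum of F, then F = f_n + O(z^(n+1)), so the square
of the identity gives a polynomial congruence modulo z^(n+1) ([dvdp_defect]).
There formal derivatives are available.  They bring in 4 z F' + F, which is
(1 - z)^(-1/2), an algebraic function, and F itself drops out
([formal_identity]).  As n is arbitrary, the congruence is an equality.

Write X = A / B in lowest terms.  That the map is algebraic is a matter of three
charts ([algebraic_phi]): near a pole of X, and near infinity, the coordinates
are rewritten with the help of the differential equation.

That the map is additive is the addition theorem for the elliptic integral.  It
is proved here by letting a line rotate about a fixed point P3 of the curve; its
slope s is a rational parameter, and the two other intersections P1, P2 with
the curve are conjugate in a quadratic extension of C(s).  The third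
intersection of the curve with the line through the images of P1 and P2 is
invariant under the conjugation, so its coordinates are rational functions of s.
But a rational parametrization of the curve is constant, by Fermat's descent
([rational_point_const]).  So that intersection does not depend on s
([pencil_dichotomy]), and it is found by letting P1 go to infinity, when P2 goes
to - P3 ([pencil_sum]).  This gives its abscissa; the sign of its ordinate is
read off from the tangent at P3 ([image_collinear]).  Because the relations
obtained are polynomial in s, they hold for every line through P3, tangents
included, and no case of the group law has to be reached by a limit. *)

(** * Polynomials *)

Lemma poly_eq0_generic (C : closedFieldType) (p m : {poly C}) : m != 0 ->
  (forall s, m.[s] != 0 -> p.[s] = 0) -> p = 0.
Proof.
move=> m0 h; apply/eqP; case: eqP => // /eqP p0.
have /closed_nonrootP[x] : p * m != 0 by rewrite mulf_neq0.
rewrite rootM negb_or => /andP[/negP px mx]; case: px.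
exact/rootP/h/mx.
Qed.

Lemma dvdp_XnP (K : fieldType) (p : {poly K}) n :
  reflect (forall i, (i < n)%N -> p`_i = 0) ('X^n %| p).
Proof.
apply: (iffP idP) => [/dvdpP[q ->] i lt_in|h].
  by rewrite coefMXn lt_in.
have -> : p = drop_poly n p * 'X^n.
  rewrite -{1}(poly_take_drop n p); have -> : take_poly n p = 0; last by rewrite add0r.
  by apply/polyP => i; rewrite coef_take_poly coef0; case: ifP => // /h.
exact: dvdp_mull.
Qed.

Lemma coprimep_Xn (K : fieldType) (p : {poly K}) n :
  p.[0] != 0 -> coprimep 'X^n p.
Proof.
move=> p0; apply: coprimep_expl; rewrite coprimep_sym -(subr0 'X).
by rewrite coprimep_XsubC.
Qed.

(** The value [d] is a bound on the degree, not the degree itself, so that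
polynomials of different degrees can be homogenized to the same degree. *)
Definition homogenize (K : comNzRingType) (S : comAlgType K) (p : {poly K}) (d : nat)
    (G H : S) : S :=
  \sum_(k < d.+1) p`_k *: (G ^+ k * H ^+ (d - k)).

Lemma homogenize_eval (K : fieldType) (p : {poly K}) d (r h : K) :
  (size p <= d.+1)%N ->
  \sum_(k < d.+1) p`_k * ((r * h) ^+ k * h ^+ (d - k)) = h ^+ d * p.[r].
Proof.
move=> sp; rewrite (horner_coef_wide _ sp) mulr_sumr.
apply: eq_bigr => k _; have kd : (k <= d)%N by rewrite -ltnS.
have -> : h ^+ d = h ^+ k * h ^+ (d - k) by rewrite -exprD subnKC.
by rewrite exprMn; ring.
Qed.

Lemma horner_homogenize (K : fieldType) (p : {poly K}) d (U V : {poly K}) z w :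
  (size p <= d.+1)%N -> U.[z] = w * V.[z] ->
  (homogenize p d U V).[z] = V.[z] ^+ d * p.[w].
Proof.
move=> sp hw; rewrite -homogenize_eval // /homogenize horner_sum.
by apply: eq_bigr => k _; rewrite hornerZ hornerM !horner_exp hw.
Qed.

(** * Rational points of the curve over a rational function field *)

Section Descent.
Variable C : numClosedFieldType.
Implicit Types p q r : {poly C}.

Lemma coprimep_mul_square p q r :
  coprimep p q -> p * q = r ^+ 2 -> exists u, p = u ^+ 2.
Proof.
have [n] := ubnP (size p); elim: n p r => // n IH p r /ltnSE szp cpq pqr.
have [/size_poly1P[k k0 ->]|/closed_rootP[x px]] := boolP (size p == 1%N).
  by exists (sqrtC k)%:P; rewrite -polyC_exp sqrtCK.
have rx : root r x.
  by apply/rootP/eqP; rewrite -sqrf_eq0 -horner_exp -pqr hornerM (rootP px) mul0r.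
have [p0|p0] := eqVneq p 0.
  by exists 0; rewrite p0 expr0n.
have cx : coprimep (('X - x%:P) ^+ 2) q.
  apply: coprimep_expl; rewrite coprimep_sym coprimep_XsubC.
  exact: (coprimep_root cpq px).
have [p1 pE] : exists p1, p = p1 * ('X - x%:P) ^+ 2.
  apply/dvdpP; rewrite -(Gauss_dvdpl _ cx) pqr dvdp_exp2r //.
  by rewrite dvdp_XsubCl.
have /dvdpP[r1 rE] : 'X - x%:P %| r by rewrite dvdp_XsubCl.
have X0 : ('X - x%:P) ^+ 2 != 0 by rewrite expf_neq0 // polyXsubC_eq0.
have [|||u p1E] := IH p1 r1.
- have p10 : p1 != 0 by apply: contraNneq p0 => e; rewrite pE e mul0r.
  apply: leq_trans szp; rewrite pE size_Mmonic ?monic_exp ?monicXsubC //.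
  by rewrite size_exp_XsubC; lia.
- by move: cpq; rewrite pE coprimepMl => /andP[].
- apply: (mulIf X0); rewrite -exprMn -rE -pqr pE; ring.
by exists (u * ('X - x%:P)); rewrite exprMn -p1E.
Qed.

Lemma coprimep_lin p q (a b c d : C) : a * d - b * c != 0 ->
  coprimep p q -> coprimep (a *: p + b *: q) (c *: p + d *: q).
Proof.
move=> D0 /Bezout_coprimepP[[u v] /= e].
have [k k0 kE] : exists2 k, k != 0 & u * p + v * q = k%:P.
  by move: e; rewrite -size_poly_eq1 => /size_poly1P[k k0 ->]; exists k.
apply/Bezout_coprimepP; exists (d *: u - c *: v, a *: v - b *: u).
rewrite /= -size_poly_eq1; apply/size_poly1P; exists ((a * d - b * c) * k).
  by rewrite mulf_neq0.
by rewrite polyCM -kE !polyCB -!mul_polyC !polyCM; ring.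
Qed.

Lemma coprimep_pm p q (k : C) : k != 0 -> coprimep p q ->
  coprimep (p + k *: q) (p - k *: q).
Proof.
move=> k0 cpq; rewrite -scaleNr -(scale1r p); apply: coprimep_lin => //.
by rewrite mul1r mulr1 -opprD oppr_eq0 -mulr2n -mulr_natl mulf_neq0 // pnatr_eq0.
Qed.

(** Fermat's descent.  If p, q, p - q, p + q are squares a^2, b^2, c^2, d^2 then
c^2 = (a - b) (a + b) and d^2 = (a - i b) (a + i b), so these four factors are
squares as well.  Up to constants they are q', p', p' - q', p' + q' for
p' = a + b and q' = i (a - b), whose degrees are half as large. *)
Lemma four_squares_const p q (a b c d : {poly C}) : coprimep p q ->
  p = a ^+ 2 -> q = b ^+ 2 -> p - q = c ^+ 2 -> p + q = d ^+ 2 ->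
  (size p <= 1)%N /\ (size q <= 1)%N.
Proof.
have [n] := ubnP (maxn (size p) (size q)).
elim: n p q a b c d => // n IH p q a b c d /ltnSE szn cpq pE qE mE dE.
have cab : coprimep a b.
  by move: cpq; rewrite pE qE coprimep_pexpl // coprimep_pexpr.
have sq (r : {poly C}) : ((size r).*2.-1 <= size (r ^+ 2))%N.
  by have [->|r0] := eqVneq r 0; rewrite ?size_poly0 // expr2 size_mul // addnn.
suff [sa sb] : (size a <= 1)%N /\ (size b <= 1)%N.
  rewrite pE qE; split; rewrite expr2.
    by apply: leq_trans (size_polyMleq _ _) _; lia.
  by apply: leq_trans (size_polyMleq _ _) _; lia.
have [|big] := leqP (maxn (size a) (size b)) 1; first by rewrite geq_max => /andP.
have i2 : 'i ^+ 2 = -1 :> C by exact: sqrCi.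
have two0 : 2 != 0 :> C by rewrite pnatr_eq0.
have i0 : 'i != 0 :> C by exact: neq0Ci.
have nzi (x : C) : x ^+ 2 = -1 -> 1 - x != 0.
  move=> xx; apply/eqP => /eqP; rewrite subr_eq0 => /eqP x1.
  move: xx; rewrite -x1 expr1n => /eqP.
  by rewrite eq_sym -subr_eq0 -opprD oppr_eq0 (_ : 1 + 1 = 2) ?(negPf two0).
have i1 := nzi _ i2.
have i1' : 1 + 'i != 0 :> C by have := nzi (- 'i); rewrite opprK sqrrN; exact.
have cab1 : coprimep (a + b) (a - b).
  by have := coprimep_pm (oner_neq0 C) cab; rewrite scale1r.
have [e1 e1E] : exists e, a - b = e ^+ 2.
  apply: (@coprimep_mul_square _ (a + b) c); first by rewrite coprimep_sym.
  by rewrite -mE pE qE; ring.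
have [f1 f1E] : exists e, a + b = e ^+ 2.
  apply: (@coprimep_mul_square _ (a - b) c) => //.
  by rewrite -mE pE qE; ring.
have dE' : (a + 'i *: b) * (a - 'i *: b) = d ^+ 2.
  rewrite -dE pE qE -!mul_polyC.
  have : ('i%:P : {poly C}) ^+ 2 = -1 by rewrite -polyC_exp i2 polyCN.
  by move=> h; ring: h.
have cpm := coprimep_pm i0 cab.
have [g gE] : exists e, a + 'i *: b = e ^+ 2.
  exact: coprimep_mul_square cpm dE'.
have [h hE] : exists e, a - 'i *: b = e ^+ 2.
  by apply: (@coprimep_mul_square _ (a + 'i *: b) d); rewrite 1?coprimep_sym // mulrC.
have sc (k : C) (r : {poly C}) : exists r', k *: r ^+ 2 = r' ^+ 2.
  by exists (sqrtC k *: r); rewrite exprZn sqrtCK.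
have [q' q'E] : exists r, 'i *: (a - b) = r ^+ 2 by rewrite e1E; exact: sc.
have [g' g'E] : exists r, (a + b) - 'i *: (a - b) = r ^+ 2.
  have [r rE] := sc (1 - 'i) g; exists r; rewrite -rE -gE -!mul_polyC polyCB.
  have : ('i%:P : {poly C}) ^+ 2 = -1 by rewrite -polyC_exp i2 polyCN.
  by move=> hi; ring: hi.
have [h' h'E] : exists r, (a + b) + 'i *: (a - b) = r ^+ 2.
  have [r rE] := sc (1 + 'i) h; exists r; rewrite -rE -hE -!mul_polyC polyCD.
  have : ('i%:P : {poly C}) ^+ 2 = -1 by rewrite -polyC_exp i2 polyCN.
  by move=> hi; ring: hi.
have [||s1 s2] := IH (a + b) ('i *: (a - b)) f1 q' g' h' _ _ f1E q'E g'E h'E.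
- have arith (x y z w k l : nat) : (1 < maxn x y)%N -> (maxn k l <= n)%N ->
    (z <= maxn x y)%N -> (w <= maxn x y)%N -> (x.*2.-1 <= k)%N ->
    (y.*2.-1 <= l)%N -> (maxn z w < n)%N by lia.
  rewrite size_scale //.
  apply: (arith (size a) (size b) _ _ (size p) (size q)) => //.
  + exact: size_polyD.
  + by rewrite (leq_trans (size_polyD _ _)) // size_polyN.
  + by rewrite pE; exact: sq.
  + by rewrite qE; exact: sq.
- by rewrite coprimepZr.
rewrite size_scale // in s2.
split; rewrite -(@size_scale _ 2) //.
  have -> : 2 *: a = (a + b) + (a - b) by rewrite scaler_nat mulr2n; ring.
  by rewrite (leq_trans (size_polyD _ _)) // geq_max s1.
have -> : 2 *: b = (a + b) - (a - b) by rewrite scaler_nat mulr2n; ring.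
by rewrite (leq_trans (size_polyD _ _)) // size_polyN geq_max s1.
Qed.

(** A point (p / q, y) of the curve over the field of rational functions has
constant coordinates: for coprime p and q, the four pairwise coprime factors of
p q (p - q) (p + q) = (q^2 y)^2 are squares. *)
Lemma rational_point_const p q r : q != 0 ->
  r ^+ 2 = p * q * (p ^+ 2 - q ^+ 2) -> exists k, p = k *: q.
Proof.
move=> q0 rE; pose g := gcdp p q.
have g0 : g != 0 by rewrite gcdp_eq0 negb_and q0 orbT.
have [p1 pE] : exists p1, p = p1 * g by apply/dvdpP; rewrite dvdp_gcdl.
have [q1 qE] : exists q1, q = q1 * g by apply/dvdpP; rewrite dvdp_gcdr.
have q10 : q1 != 0 by apply: contraNneq q0 => e; rewrite qE e mul0r.
have cpq : coprimep p1 q1.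
  have := @coprimep_div_gcd _ p q; rewrite q0 orbT => /(_ isT).
  by rewrite -/g {1}pE {1}qE !mulpK.
have [r1 r1E] : exists r1, r = r1 * g ^+ 2.
  apply/dvdpP; rewrite -(@dvdp_pexp2r _ _ _ 2) // rE pE qE.
  by apply/dvdpP; exists (p1 * q1 * (p1 ^+ 2 - q1 ^+ 2)); ring.
have e : r1 ^+ 2 = p1 * q1 * ((p1 - q1) * (p1 + q1)).
  apply: (mulIf (expf_neq0 4 g0)); transitivity (r ^+ 2); first by rewrite r1E; ring.
  by rewrite rE pE qE; ring.
have cm : coprimep (p1 - q1) (p1 + q1).
  by have := coprimep_pm (oner_neq0 C) cpq; rewrite scale1r coprimep_sym.
have cpm (k : C) : k != 0 -> coprimep p1 (p1 + k *: q1).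
  by move=> k0; rewrite -{2}(mul1r p1) coprimep_addl_mul coprimepZr.
have cqm (k : C) : k != 0 -> coprimep q1 (k *: q1 + p1).
  by move=> k0; rewrite -mul_polyC coprimep_addl_mul coprimep_sym.
have cp_p : coprimep p1 (p1 + q1).
  by have := cpm 1; rewrite scale1r oner_neq0; exact.
have cp_m : coprimep p1 (p1 - q1).
  by have := cpm (-1); rewrite scaleN1r oppr_eq0 oner_neq0; exact.
have cq_p : coprimep q1 (p1 + q1).
  by rewrite addrC; have := cqm 1; rewrite scale1r oner_neq0; exact.
have cq_m : coprimep q1 (p1 - q1).
  by rewrite addrC; have := cqm (-1); rewrite scaleN1r oppr_eq0 oner_neq0; exact.
have [a aE] : exists a, p1 = a ^+ 2.
  apply: (@coprimep_mul_square _ (q1 * ((p1 - q1) * (p1 + q1))) r1).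
    by rewrite !coprimepMr cpq cp_m.
  by rewrite e; ring.
have [b bE] : exists a, q1 = a ^+ 2.
  apply: (@coprimep_mul_square _ (p1 * ((p1 - q1) * (p1 + q1))) r1).
    by rewrite !coprimepMr cq_m cq_p coprimep_sym cpq.
  by rewrite e; ring.
have [c cE] : exists a, p1 - q1 = a ^+ 2.
  apply: (@coprimep_mul_square _ (p1 * q1 * (p1 + q1)) r1).
    by rewrite !coprimepMr coprimep_sym cp_m coprimep_sym cq_m cm.
  by rewrite e; ring.
have [d dE] : exists a, p1 + q1 = a ^+ 2.
  apply: (@coprimep_mul_square _ (p1 * q1 * (p1 - q1)) r1).
    by rewrite !coprimepMr coprimep_sym cp_p coprimep_sym cq_p coprimep_sym cm.
  by rewrite e; ring.
have [s1 s2] := four_squares_const cpq aE bE cE dE.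
have [k pk] : exists k, p1 = k%:P by exists p1`_0; exact: size1_polyC.
have [l ql] : exists k, q1 = k%:P by exists q1`_0; exact: size1_polyC.
have l0 : l != 0 by rewrite -polyC_eq0 -ql.
exists (k / l); rewrite pE qE pk ql -mul_polyC mulrA -polyCM divfK //.
Qed.

End Descent.

(** * Collinear points of the curve *)

Section Collinear.
Variable K : fieldType.

(** This says that x^3 - x - (s x + t)^2 = (x - x1) (x - x2) (x - x3), i.e. that
the line y = s x + t meets the curve in the points of abscissas x1, x2, x3.
Tangents are included, as multiplicities are taken into account. *)
Definition collinear (s t x1 x2 x3 : K) :=
  [/\ s ^+ 2 = x1 + x2 + x3, 1 + 2 * s * t + (x1 * x2 + x1 * x3 + x2 * x3) = 0
    & t ^+ 2 = x1 * x2 * x3].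

Lemma collinear_on s t x1 x2 x3 :
  collinear s t x1 x2 x3 -> (s * x3 + t) ^+ 2 = x3 ^+ 3 - x3.
Proof.
move=> [e1 e2 e3].
transitivity (s ^+ 2 * x3 ^+ 2 + (1 + 2 * s * t + (x1 * x2 + x1 * x3 + x2 * x3)) * x3
  + t ^+ 2 - x3 - (x1 * x2 + x1 * x3 + x2 * x3) * x3); first by ring.
by rewrite e1 e2 e3; ring.
Qed.

Lemma collinear_rot s t x1 x2 x3 :
  collinear s t x1 x2 x3 -> collinear s t x2 x3 x1.
Proof.
move=> [e1 e2 e3]; split; first by rewrite e1; ring.
  by rewrite -e2; ring.
by rewrite e3; ring.
Qed.

Lemma collinear_swap s t x1 x2 x3 :
  collinear s t x1 x2 x3 -> collinear s t x2 x1 x3.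
Proof.
move=> [e1 e2 e3]; split; first by rewrite e1; ring.
  by rewrite -e2; ring.
by rewrite e3; ring.
Qed.

Lemma tangent_collinear x y : 2 != 0 :> K -> y != 0 -> y ^+ 2 = x ^+ 3 - x ->
  let s := (3 * x ^+ 2 - 1) / (2 * y) in
  collinear s (y - s * x) x x (s ^+ 2 - x - x).
Proof.
move=> n2 y0 on s.
have sE : 2 * s * y = 3 * x ^+ 2 - 1 by rewrite /s; field; rewrite n2 y0.
split; first by ring.
  transitivity (1 + 2 * s * y - 3 * x ^+ 2); first by ring.
  by rewrite sE; ring.
transitivity (y ^+ 2 - (2 * s * y) * x + s ^+ 2 * x ^+ 2); first by ring.
by rewrite sE on; ring.
Qed.

Lemma chord_collinear x1 y1 x2 y2 : x1 != x2 ->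
  y1 ^+ 2 = x1 ^+ 3 - x1 -> y2 ^+ 2 = x2 ^+ 3 - x2 ->
  let s := (y2 - y1) / (x2 - x1) in
  collinear s (y1 - s * x1) x1 x2 (s ^+ 2 - x1 - x2).
Proof.
move=> ne on1 on2 s.
have d0 : x2 - x1 != 0 by rewrite subr_eq0 eq_sym.
have yE : y2 = y1 + s * (x2 - x1) by rewrite /s divfK //; ring.
have key : 2 * y1 * s + s ^+ 2 * (x2 - x1) = x2 ^+ 2 + x1 * x2 + x1 ^+ 2 - 1.
  apply: (mulIf d0); transitivity (y2 ^+ 2 - y1 ^+ 2); first by rewrite yE; ring.
  by rewrite on1 on2; ring.
split; first by ring.
  transitivity (1 + (2 * y1 * s + s ^+ 2 * (x2 - x1)) - (x2 ^+ 2 + x1 * x2 + x1 ^+ 2)).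
    by ring.
  by rewrite key; ring.
transitivity (y1 ^+ 2 - (2 * y1 * s + s ^+ 2 * (x2 - x1)) * x1 + s ^+ 2 * x1 * x2).
  by ring.
by rewrite on1 key; ring.
Qed.

End Collinear.

Section GroupLaw.
Variable K : fieldType.
Hypothesis two0 : 2 != 0 :> K.
Implicit Types x y s t : K.

Lemma E1val_inj (P Q : E1 K) : E1val P = E1val Q -> P = Q.
Proof.
case: P Q => [P hP] [Q hQ] /= e; case: Q / e in hQ *.
by congr MkE1; exact: bool_irrelevance.
Qed.

Lemma padd_opp x y : padd (Aff x y) (Aff x (- y)) = Inf K.
Proof. by rewrite /= eqxx opprK eqxx. Qed.

(** The converse of [chord_collinear] and [tangent_collinear]. *)
Lemma padd_collinear s t x1 x2 x3 : collinear s t x1 x2 x3 ->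
  padd (Aff x1 (s * x1 + t)) (Aff x2 (s * x2 + t)) = Aff x3 (- (s * x3 + t)).
Proof.
move=> [e1 e2 e3]; have chordE : chord x1 (s * x1 + t) x2 s = Aff x3 (- (s * x3 + t)).
  rewrite /chord; have -> : s ^+ 2 - x1 - x2 = x3 by rewrite e1; ring.
  by congr Aff; ring.
rewrite /padd; have [x12|ne] /= := eqVneq x1 x2; last first.
  rewrite (_ : _ / _ = s) //; field; by rewrite subr_eq0 eq_sym.
subst x2; have tangent : 2 * (s * x1 + t) * s = 3 * x1 ^+ 2 - 1.
  transitivity (2 * s ^+ 2 * x1 + (1 + 2 * s * t + (x1 * x1 + x1 * x3 + x1 * x3))
    - 1 - x1 ^+ 2 - 2 * x1 * x3); first by ring.
  by rewrite e1 e2; ring.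
have y0 : s * x1 + t != 0.
  apply/eqP => y0; have tE : t = - (s * x1) by apply/eqP; rewrite -addr_eq0 addrC y0.
  have x10 : x1 = 0.
    have : 2 * x1 ^+ 3 = 0.
      transitivity ((x1 + x1 + x3) * x1 ^+ 2 - x1 * x1 * x3); first by ring.
      by rewrite -e1 -e3 tE; ring.
    by move/eqP; rewrite mulf_eq0 (negPf two0) expf_eq0 => /eqP.
  move/eqP: tangent; rewrite y0 x10 expr0n !(mulr0, mul0r) sub0r eq_sym oppr_eq0.
  by rewrite oner_eq0.
case: ifPn => [|_].
  by rewrite -addr_eq0 -mulr2n -mulr_natl mulf_eq0 (negPf two0) (negPf y0).
rewrite (_ : _ / _ = s) //.
by rewrite -tangent mulrC mulKf ?mulf_neq0.
Qed.

Lemma collinear_or_opp x1 y1 x2 y2 :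
  y1 ^+ 2 = x1 ^+ 3 - x1 -> y2 ^+ 2 = x2 ^+ 3 - x2 ->
  (x1 = x2 /\ y2 = - y1) \/
  exists s t x3, [/\ collinear s t x1 x2 x3, y1 = s * x1 + t & y2 = s * x2 + t].
Proof.
move=> on1 on2; have [x12|ne] := eqVneq x1 x2; last first.
  right; have := chord_collinear ne on1 on2; set s := _ / _ => /= h.
  exists s, (y1 - s * x1), (s ^+ 2 - x1 - x2); split=> //; first by ring.
  by rewrite /s; field; rewrite subr_eq0 eq_sym.
subst x2; have : (y2 - y1) * (y2 + y1) == 0 by rewrite -subr_sqr on1 on2 subrr.
rewrite mulf_eq0 subr_eq0 addr_eq0 => /orP[|] /eqP yE; last by left.
have [y0|y0] := eqVneq y1 0; first by left; rewrite yE y0 oppr0.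
right; have /= := tangent_collinear two0 y0 on1; set s := _ / _ => h.
by exists s, (y1 - s * x1), (s ^+ 2 - x1 - x1); split=> //; rewrite ?yE; ring.
Qed.

End GroupLaw.

(** For the abscissas a0 + a1 v and a0 - a1 v, with ordinates b0 + b1 v and
b0 - b1 v, where v^2 = D, of two points of the curve, these are Vieta's formulas
for the chord with equation y = S x + T.  Here n is the product of the two
abscissas, and x is the abscissa of the third intersection. *)
Lemma chord_third_point (F : fieldType) (a0 a1 b0 b1 D : F) : a1 != 0 ->
  b0 ^+ 2 + D * b1 ^+ 2 = a0 ^+ 3 + 3 * a0 * D * a1 ^+ 2 - a0 ->
  2 * b0 * b1 = 3 * a0 ^+ 2 * a1 + D * a1 ^+ 3 - a1 ->
  let S := b1 / a1 in let T := b0 - S * a0 in let x := S ^+ 2 - 2 * a0 in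
  let n := a0 ^+ 2 - D * a1 ^+ 2 in
  [/\ n + x * (2 * a0) = - 1 - 2 * S * T & n * x = T ^+ 2].
Proof.
move=> a10 e1 e2 S T x n.
have bE : b1 = S * a1 by rewrite /S divfK.
have tE : b0 = S * a0 + T by rewrite /T; ring.
have e2' : 2 * (S * a0 + T) * S = 3 * a0 ^+ 2 + D * a1 ^+ 2 - 1.
  apply: (mulIf a10); transitivity (2 * b0 * b1); first by rewrite bE tE; ring.
  by rewrite e2; ring.
have E1 : n + x * (2 * a0) = - 1 - 2 * S * T.
  transitivity (2 * (S * a0 + T) * S - (3 * a0 ^+ 2 + D * a1 ^+ 2 - 1)
     + (- 1 - 2 * S * T)); first by rewrite /n /x; ring.
  by rewrite e2' subrr add0r.
split=> //.
have e1' : (S * a0 + T) ^+ 2 + D * (S * a1) ^+ 2 - (a0 ^+ 3 + 3 * a0 * D * a1 ^+ 2 - a0) = 0.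
  by rewrite -bE -tE e1 subrr.
have E1' : n + x * (2 * a0) - (- 1 - 2 * S * T) = 0 by rewrite E1 subrr.
apply/eqP; rewrite -subr_eq0; apply/eqP.
transitivity (- ((S * a0 + T) ^+ 2 + D * (S * a1) ^+ 2 - (a0 ^+ 3 + 3 * a0 * D * a1 ^+ 2 - a0)) 
   + a0 * (n + x * (2 * a0) - (- 1 - 2 * S * T))); last first.
  by rewrite e1' E1' mulr0 addr0 oppr0.
by rewrite /n /x; ring.
Qed.

(** * The pencil of lines through a point of the curve *)

(** A line of slope s through the point (x3, y3) of the curve meets the curve
again in the points of abscissas [pencil_mid.[s] + u] and [pencil_mid.[s] - u],
where u is a square root of [pencil_disc.[s]]. *)
Section Pencil.
Variables (C : numClosedFieldType) (x3 y3 : C).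
Hypothesis P3_on : y3 ^+ 2 = x3 ^+ 3 - x3.
Implicit Types (p q m : {poly C}) (s u : C).

(* Both definitions are locked because rewriting with hornerE would otherwise
   unfold them. *)
Definition pencil_mid : {poly C} := locked (2^-1 *: ('X ^+ 2 - x3%:P)).

Definition pencil_disc : {poly C} :=
  locked (pencil_mid ^+ 2 - ((x3 ^+ 2 - 1)%:P + x3 *: 'X ^+ 2 - (2 * y3) *: 'X)).

Definition on_pencil s u := u ^+ 2 = pencil_disc.[s].

Definition pencil_x s u := pencil_mid.[s] + u.

Definition pencil_y s u := s * (pencil_x s u - x3) + y3.

Let two0 : 2 != 0 :> C. Proof. by rewrite pnatr_eq0. Qed.

Lemma pencil_midE s : pencil_mid.[s] = (s ^+ 2 - x3) / 2.
Proof. by rewrite /pencil_mid -lock !hornerE; field. Qed.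

Lemma pencil_discE s : pencil_disc.[s] =
  pencil_mid.[s] ^+ 2 - (x3 ^+ 2 - 1 + x3 * s ^+ 2 - 2 * y3 * s).
Proof. by rewrite /pencil_disc -lock !hornerE; ring. Qed.

Lemma on_pencilN s u : on_pencil s u -> on_pencil s (- u).
Proof. by rewrite /on_pencil sqrrN. Qed.

Lemma on_pencil_ex s : exists u, on_pencil s u.
Proof. by exists (sqrtC pencil_disc.[s]); rewrite /on_pencil sqrtCK. Qed.

Lemma pencil_x_sum s u : pencil_x s u + pencil_x s (- u) = s ^+ 2 - x3.
Proof. by rewrite /pencil_x pencil_midE; field. Qed.

Lemma pencil_x_prod s u : on_pencil s u ->
  pencil_x s u * pencil_x s (- u) = x3 ^+ 2 - 1 + x3 * s ^+ 2 - 2 * y3 * s.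
Proof.
rewrite /on_pencil pencil_discE => h.
have -> : pencil_x s u * pencil_x s (- u) = pencil_mid.[s] ^+ 2 - u ^+ 2 by rewrite /pencil_x; ring.
by rewrite h; ring.
Qed.

Lemma pencil_y_sqr s u : on_pencil s u -> pencil_y s u ^+ 2 = pencil_x s u ^+ 3 - pencil_x s u.
Proof.
move=> h; have h1 := pencil_x_sum s u; have h2 := pencil_x_prod h.
have -> : pencil_y s u ^+ 2 =
    s ^+ 2 * (pencil_x s u - x3) ^+ 2 + 2 * s * y3 * (pencil_x s u - x3) + y3 ^+ 2.
  by rewrite /pencil_y; ring.
move: (pencil_x s u) (pencil_x s (- u)) h1 h2 => x1 x2 h1 h2.
have sE : s ^+ 2 = x1 + x2 + x3 by rewrite h1; ring.
have tE : 2 * s * y3 = x3 ^+ 2 - 1 + x3 * s ^+ 2 - x1 * x2 by rewrite h2; ring.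
by rewrite tE sE P3_on; ring.
Qed.

Lemma pencil_disc_neq0 : pencil_disc != 0.
Proof.
have mE : 2 *: pencil_mid = 'X ^+ 2 - x3%:P by rewrite /pencil_mid -lock scalerA divff ?scale1r.
have dE : 4 *: pencil_disc =
    'X^4 - (6 * x3) *: 'X^2 + (8 * y3) *: 'X + (4 - 3 * x3 ^+ 2)%:P.
  transitivity ((2 *: pencil_mid) ^+ 2 - 4 *:
      ((x3 ^+ 2 - 1)%:P + x3 *: 'X ^+ 2 - (2 * y3) *: 'X)).
    by rewrite /pencil_disc -lock -!mul_polyC; ring.
  by rewrite mE -!mul_polyC; ring.
apply/eqP => d0; have : (4 *: pencil_disc)`_4 = 0 by rewrite d0 scaler0 coef0.
rewrite dE !coefE /= !(mulr0, subr0, addr0) => /eqP.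
by rewrite oner_eq0.
Qed.

(** The functions p0 + u p1 with p0, p1 polynomials in s: the coordinate ring of
the quadratic extension, in which changing the sign of u is the conjugation. *)
Definition pencil_fun (f : C -> C -> C) :=
  exists p0 p1 : {poly C}, forall s u, on_pencil s u -> f s u = p0.[s] + u * p1.[s].

Lemma pencil_horner p : exists p0 p1 : {poly C}, forall s u, on_pencil s u ->
  p.[pencil_x s u] = p0.[s] + u * p1.[s].
Proof.
elim/poly_ind: p => [|p k [p0 [p1 ih]]].
  by exists 0, 0 => s u _; rewrite !hornerE.
exists (p0 * pencil_mid + pencil_disc * p1 + k%:P), (p0 + pencil_mid * p1) => s u h.
rewrite !hornerE ih // /pencil_x (esym h : pencil_disc.[s] = _); ring.
Qed.

Lemma pencil_funM f g : pencil_fun f -> pencil_fun g ->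
  pencil_fun (fun s u => f s u * g s u).
Proof.
move=> [p0 [p1 hp]] [q0 [q1 hq]].
exists (p0 * q0 + pencil_disc * p1 * q1), (p0 * q1 + p1 * q0) => s u h.
rewrite hp // hq // !hornerE (esym h : pencil_disc.[s] = _); ring.
Qed.

Lemma pencil_fun_y : pencil_fun pencil_y.
Proof.
exists ('X * (pencil_mid - x3%:P) + y3%:P), 'X => s u _.
by rewrite /pencil_y /pencil_x !hornerE; ring.
Qed.

Lemma pencil_fun_conj f : pencil_fun f -> pencil_fun (fun s u => f s (- u)).
Proof.
move=> [p0 [p1 hp]]; exists p0, (- p1) => s u h.
by rewrite (hp _ _ (on_pencilN h)) !hornerE; ring.
Qed.

Lemma pencil_eq0 p0 p1 m : m != 0 ->
  (forall s u, on_pencil s u -> m.[s] != 0 -> p0.[s] + u * p1.[s] = 0) ->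
  p0 = 0 /\ p1 = 0.
Proof.
move=> m0 h; have dm0 : pencil_disc * m != 0 by rewrite mulf_neq0 ?pencil_disc_neq0.
have key s : (pencil_disc * m).[s] != 0 -> p0.[s] = 0 /\ p1.[s] = 0.
  rewrite hornerM mulf_eq0 negb_or => /andP[ds ms].
  have [u hu] := on_pencil_ex s.
  have u0 : u != 0 by apply: contraNneq ds => u0; rewrite -hu u0 expr0n.
  have e1 := h _ _ hu ms; have := h _ _ (on_pencilN hu) ms => e2.
  have p00 : p0.[s] = 0.
    apply: (mulfI two0); rewrite mulr0.
    transitivity ((p0.[s] + u * p1.[s]) + (p0.[s] + - u * p1.[s])); first by ring.
    by rewrite e1 e2 addr0.
  split=> //; apply: (mulfI u0); by rewrite mulr0 -e1 p00 add0r.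
by split; apply: (poly_eq0_generic dm0) => s ks; case: (key s ks).
Qed.

(** For a root r of p, (x1 - r) (x2 - r) is a polynomial in s.  It is not zero:
otherwise r = x3 and y3 = 0, and every line through (x3, y3) would be tangent to
the curve there, which would be a singular point. *)
Lemma pencil_horner_neq0 p : p != 0 -> exists2 m, m != 0 &
  forall s u, on_pencil s u -> m.[s] != 0 -> p.[pencil_x s u] != 0.
Proof.
move=> p0; have [rs pE] := closed_field_poly_normal p.
pose q r : {poly C} := (x3 - r) *: 'X ^+ 2 - (2 * y3) *: 'X
  + (r ^+ 2 + r * x3 + x3 ^+ 2 - 1)%:P.
exists (\prod_(r <- rs) q r).
  elim: rs {pE} => [|r rs ih]; rewrite ?big_nil ?oner_eq0 // big_cons mulf_neq0 //.
  apply/eqP => q0.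
  have h2 : (q r)`_2 = 0 by rewrite q0 coef0.
  have h1 : (q r)`_1 = 0 by rewrite q0 coef0.
  have h0 : (q r)`_0 = 0 by rewrite q0 coef0.
  move: h2 h1 h0; rewrite /q !coefE /= !(mulr0, mulr1, subr0, addr0, sub0r, oppr0, add0r).
  move/eqP; rewrite subr_eq0 => /eqP <- /eqP.
  rewrite oppr_eq0 mulf_eq0 (negPf two0) /= => /eqP y0 h.
  have := P3_on; rewrite y0 expr0n /= => h'.
  have x0 : x3 = 0.
    apply: (mulfI two0); transitivity (x3 * (x3 ^+ 2 + x3 * x3 + x3 ^+ 2 - 1) -
      3 * (x3 ^+ 3 - x3)); first by ring.
    by rewrite h -h' !mulr0 subrr.
  by move/eqP: h; rewrite x0 expr0n /= mulr0 !add0r oppr_eq0 oner_eq0.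
move=> s u h; rewrite pE hornerZ mulf_eq0 lead_coef_eq0 (negPf p0) /=.
rewrite !horner_prod; elim: rs {pE} => [|r rs ih].
  by rewrite !big_nil oner_neq0.
rewrite !big_cons !mulf_eq0 !negb_or => /andP[qr /ih ->]; rewrite andbT.
apply: contraNneq qr; rewrite /q !(hornerD, hornerN, hornerZ, hornerXn, hornerX, hornerC) => e.
have e1 : pencil_x s u = r by apply/eqP; rewrite -subr_eq0 e.
have := pencil_x_prod h; have -> : pencil_x s (- u) = s ^+ 2 - x3 - r.
  by rewrite -(pencil_x_sum s u) e1; ring.
rewrite e1 => e2; apply/eqP.
transitivity ((x3 ^+ 2 - 1 + x3 * s ^+ 2 - 2 * y3 * s) - r * (s ^+ 2 - x3 - r)).
  by ring.
by rewrite e2 subrr.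
Qed.

End Pencil.

Lemma collinear_pencil (C : numClosedFieldType) (s t x1 x2 x3 : C) :
  collinear s t x1 x2 x3 ->
  let u := (x1 - x2) / 2 in
  [/\ on_pencil x3 (s * x3 + t) s u, pencil_x x3 s u = x1, pencil_x x3 s (- u) = x2,
      pencil_y x3 (s * x3 + t) s u = s * x1 + t
    & pencil_y x3 (s * x3 + t) s (- u) = s * x2 + t].
Proof.
move=> [e1 e2 e3] u.
have mE : (pencil_mid x3).[s] = (x1 + x2) / 2 by rewrite pencil_midE e1; field.
have a1 : pencil_x x3 s u = x1 by rewrite /pencil_x mE /u; field.
have a2 : pencil_x x3 s (- u) = x2 by rewrite /pencil_x mE /u; field.
split=> //; last 2 first.
- by rewrite /pencil_y a1; ring.
- by rewrite /pencil_y a2; ring.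
rewrite /on_pencil pencil_discE mE.
have -> : 2 * (s * x3 + t) * s = 2 * s ^+ 2 * x3
    + (1 + 2 * s * t + (x1 * x2 + x1 * x3 + x2 * x3))
    - 1 - (x1 * x2 + x1 * x3 + x2 * x3) by ring.
by rewrite e2 e1 /u; field.
Qed.

(** * Limits at infinity *)

Section Limits.
Variable C : numClosedFieldType.
Implicit Types (p : {poly C}).

Lemma cvg_horner (T : Type) (F : set_system T) {FF : Filter F} (f : T -> C) a p :
  f x @[x --> F] --> a -> p.[f x] @[x --> F] --> p.[a].
Proof.
move=> fa; elim/poly_ind: p => [|p k ih].
  by under eq_fun do rewrite horner0; rewrite horner0; exact: cvg_cst.
rewrite hornerD hornerMX hornerC.
under eq_fun do rewrite hornerD hornerMX hornerC.
by apply: cvgD; [apply: cvgM|apply: cvg_cst].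
Qed.

Lemma cvg_near0_eq (T : Type) (F : set_system T) {FF : ProperFilter F} (f : T -> C) a :
  f x @[x --> F] --> a -> (\forall x \near F, f x = 0) -> a = 0.
Proof.
move=> fa f0; apply: (@norm_cvg_unique C C^o (f x @[x --> F])) => //.
exact: cvg_near_cst.
Qed.

Lemma cvg_dominated0 (T : Type) (F : set_system T) {FF : Filter F} (f g : T -> C) :
  (\forall x \near F, `|f x| <= `|g x|) -> g x @[x --> F] --> (0 : C) ->
  f x @[x --> F] --> (0 : C).
Proof.
move=> fg /cvgr0Pnorm_lt g0; apply/cvgr0Pnorm_lt => e e0.
by apply: filterS2 fg (g0 e e0) => x; exact: le_lt_trans.
Qed.

Lemma cvg_cinftyV : s^-1 @[s --> (@cinfty C)] --> (0 : C).
Proof.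
apply/cvgr0Pnorm_lt => e e0; exists e^-1; split.
  by rewrite realV gtr0_real.
move=> s es; have s0 : 0 < `|s| by apply: lt_trans es; rewrite invr_gt0.
by rewrite normfV invf_plt ?posrE.
Qed.

(** The polynomial z^n p(1 / z), used to evaluate p at infinity. *)
Definition revp p n : {poly C} := \poly_(i < n.+1) p`_(n - i).

Lemma revp_horner p n z : (size p <= n.+1)%N -> z != 0 ->
  (revp p n).[z] = z ^+ n * p.[z^-1].
Proof.
move=> sp z0; rewrite /revp horner_poly (horner_coef_wide _ sp) mulr_sumr.
rewrite (reindex_inj rev_ord_inj) /=; apply: eq_bigr => i _.
have ilen : (i <= n)%N by rewrite -ltnS.
rewrite subSS subKn // [RHS]mulrCA; congr (_ * _).
rewrite exprVn; apply: (canRL (mulfK (expf_neq0 i z0))).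
by rewrite -exprD subnK.
Qed.

Lemma revp0 p n : (revp p n).[0] = p`_n.
Proof. by rewrite horner_coef0 coef_poly subn0. Qed.

Lemma cinfty_neq0 : \forall s \near (@cinfty C), s != 0.
Proof.
exists 0; split; rewrite ?real0 // => s.
by rewrite normr_gt0.
Qed.

Lemma near_cinfty_horner_neq0 p : p != 0 -> \forall s \near (@cinfty C), p.[s] != 0.
Proof.
move=> p0; have FF : Filter (@cinfty C) by exact: _.
have h := cvg_horner (FF := FF) (p := revp p (size p).-1) cvg_cinftyV.
have l0 : (revp p (size p).-1).[0] != 0 by rewrite revp0 -lead_coefE lead_coef_eq0.
apply: filterS2 cinfty_neq0 (cvgr_neq0 _ h l0) => s s0.
rewrite revp_horner ?invr_eq0 // ?invrK ?leqSpred //.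
by rewrite mulf_eq0 negb_or => /andP[].
Qed.

End Limits.

Section PencilLimit.
Variables (C : numClosedFieldType) (x3 y3 : C).
Local Notation on_pencil := (on_pencil x3 y3).
Local Notation pencil_x := (pencil_x x3).

(** When the line becomes vertical, one intersection goes to infinity and the
other one to the opposite of the fixed point.  The root u is the one for which
the first abscissa p + x3 is farther from x3 than the second one q + x3; then
p q is linear in s while p + q is quadratic, so that q goes to 0. *)
Lemma pencil_limit : exists u : C -> C,
  [/\ forall s, on_pencil s (u s),
      (pencil_x s (u s))^-1 @[s --> cinfty] --> (0 : C)
    & pencil_x s (- u s) @[s --> cinfty] --> x3].
Proof.
pose r s := sqrtC (pencil_disc x3 y3).[s].
pose u s := if `|pencil_x s (- r s) - x3| <= `|pencil_x s (r s) - x3| then r s else - r s.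
have hr s : on_pencil s (r s) by rewrite /on_pencil sqrtCK.
have hu s : on_pencil s (u s) by rewrite /u; case: ifP => _ //; exact: on_pencilN.
have big s : `|pencil_x s (- u s) - x3| <= `|pencil_x s (u s) - x3|.
  rewrite /u; case: ifPn => // h; rewrite opprK.
  by rewrite ltW // real_ltNge ?normr_real.
pose p s := pencil_x s (u s) - x3; pose q s := pencil_x s (- u s) - x3.
have pq s : p s + q s = s ^+ 2 - 3 * x3.
  by have := pencil_x_sum x3 s (u s); rewrite /p /q => e; rewrite addrACA e; ring.
have pMq s : p s * q s = 3 * x3 ^+ 2 - 1 - 2 * y3 * s.
  have e1 := pencil_x_sum x3 s (u s); have e2 := pencil_x_prod (hu s).
  transitivity (pencil_x s (u s) * pencil_x s (- u s) - x3 * (pencil_x s (u s) + pencil_x s (- u s))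
    + x3 ^+ 2); first by rewrite /p /q; ring.
  by rewrite e1 e2; ring.
have FF : Filter (@cinfty C) by exact: _.
have lim0 (a b k : C) : (a * s + b) / (s ^+ 2 - k) @[s --> cinfty] --> (0 : C).
  have hE := (hornerD, hornerN, hornerZ, hornerXn, hornerX, hornerC).
  have hn := cvg_horner (FF := FF) (p := a *: 'X + b *: 'X ^+ 2) (@cvg_cinftyV C).
  have hd := cvg_horner (FF := FF) (p := 1%:P - k *: 'X ^+ 2) (@cvg_cinftyV C).
  have d1 : (1%:P - k *: 'X ^+ 2).[0] = 1.
    by rewrite !hE expr0n /= mulr0 subr0.
  have n0 : (a *: 'X + b *: 'X ^+ 2).[0] = 0.
    by rewrite !hE expr0n /= !mulr0 addr0.
  rewrite d1 in hd; rewrite n0 in hn.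
  have := cvgM (FF := FF) hn (cvgV (FF := FF) (oner_neq0 _) hd); rewrite mul0r.
  apply: cvg_trans; apply: near_eq_cvg.
  near=> s.
  have s0 : s != 0 by near: s; exact: cinfty_neq0.
  have sk : s ^+ 2 - k != 0.
    near: s; have := @near_cinfty_horner_neq0 _ ('X ^+ 2 - k%:P).
    rewrite -size_poly_gt0 size_XnsubC // => /(_ isT).
    by apply: filterS => s; rewrite hornerD hornerN hornerXn hornerC.
  rewrite /= !(hornerD, hornerN, hornerZ, hornerXn, hornerX, hornerC).
  by field; rewrite sk s0.
have nz : \forall s \near (@cinfty C), s ^+ 2 - 3 * x3 != 0.
  have := @near_cinfty_horner_neq0 _ ('X ^+ 2 - (3 * x3)%:P).
  rewrite -size_poly_gt0 size_XnsubC // => /(_ isT).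
  by apply: filterS => s; rewrite hornerD hornerN hornerXn hornerC.
have p_big s : `|s ^+ 2 - 3 * x3| <= 2 * `|p s|.
  rewrite -pq (le_trans (ler_normD _ _)) // mulr_natl mulr2n lerD2l.
  exact: big.
have pn0 : \forall s \near (@cinfty C), p s != 0.
  apply: filterS nz => s; apply: contraNneq => p0.
  by have := p_big s; rewrite p0 normr0 mulr0 normr_le0.
have pV : (p s)^-1 @[s --> cinfty] --> (0 : C).
  apply: (cvg_dominated0 (FF := FF) _ (lim0 0 2 (3 * x3))).
  apply: filterS2 nz pn0 => s s0 p0.
  rewrite mul0r add0r normrM !normfV ger0_norm ?ler0n //.
  rewrite ler_pdivlMr ?normr_gt0 // mulrC ler_pdivrMr ?normr_gt0 //.
have qlim : q s @[s --> cinfty] --> (0 : C).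
  apply: (cvg_dominated0 (FF := FF) _ (lim0 (- 4 * y3) (2 * (3 * x3 ^+ 2 - 1)) (3 * x3))).
  apply: filterS2 nz pn0 => s s0 p0.
  have -> : - 4 * y3 * s + 2 * (3 * x3 ^+ 2 - 1) = 2 * (p s * q s).
    by rewrite pMq; ring.
  rewrite normrM normfV ler_pdivlMr ?normr_gt0 // !normrM mulrC mulrA.
  by rewrite ler_wpM2r // ger0_norm ?ler0n.
exists u; split=> //.
  have : (p s)^-1 * (1 + x3 * (p s)^-1)^-1 @[s --> cinfty] --> (0 * (1 + x3 * 0)^-1 : C).
    apply: cvgM => //; apply: cvgV; first by rewrite mulr0 addr0 oner_neq0.
    by apply: cvgD; [exact: cvg_cst|apply: cvgM => //; exact: cvg_cst].
  rewrite mul0r; apply: cvg_trans; apply: near_eq_cvg.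
  apply: filterS pn0 => s p0 /=.
  have -> : pencil_x s (u s) = p s + x3 by rewrite /p subrK.
  by rewrite -invfM mulrDr mulr1 mulrCA divff // mulr1.
have -> : (fun s => pencil_x s (- u s)) = (fun s => q s + x3).
  by apply/funext => s; rewrite /q subrK.
rewrite -{2}(add0r x3); apply: cvgD => //; exact: cvg_cst.
Unshelve. all: by end_near.
Qed.

End PencilLimit.

(** * Rational maps satisfying the differential equation *)

(** For X = A / B and W = A' B - A B' = B^2 X', the equation [ode] is
c^2 (x^3 - x) X'^2 = X^3 - X. *)
Section RationalMap.
Variables (C : numClosedFieldType) (A B W : {poly C}) (c : C).
Hypothesis B_neq0 : B != 0.
Hypothesis AB_coprime : coprimep A B.
Hypothesis size_AB : size A = (size B).+1.
Hypothesis ode : forall x, c ^+ 2 * (x ^+ 3 - x) * W.[x] ^+ 2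
  = A.[x] * B.[x] * (A.[x] ^+ 2 - B.[x] ^+ 2).
Implicit Types x y s t : C.

Let two0 : 2 != 0 :> C. Proof. by rewrite pnatr_eq0. Qed.

Section ImagePencil.
Variables x3 y3 : C.
Hypothesis P3_on : y3 ^+ 2 = x3 ^+ 3 - x3.
Local Notation on_pencil := (on_pencil x3 y3).
Local Notation pencil_x := (pencil_x x3).
Local Notation pencil_y := (pencil_y x3 y3).

(** The image of the moving point (x1, y1) is (a / M, b / M^2) with
a = [pencil_num s u], M = [pencil_den s u], b = [pencil_ynum s u].  The
denominator B(x1) is completed to a polynomial M = B(x1) B(x2) in s, invariant
under conjugation. *)
Definition pencil_num s u := A.[pencil_x s u] * B.[pencil_x s (- u)].

Definition pencil_den s u := B.[pencil_x s u] * B.[pencil_x s (- u)].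

Definition pencil_ynum s u := c * pencil_y s u * W.[pencil_x s u] * B.[pencil_x s (- u)] ^+ 2.

Lemma pencil_den_poly : exists M : {poly C}, forall s u, on_pencil s u ->
  pencil_den s u = M.[s].
Proof.
have [B0 [B1 BE]] := pencil_horner x3 y3 B.
exists (B0 ^+ 2 - pencil_disc x3 y3 * B1 ^+ 2) => s u h.
rewrite /pencil_den (BE _ _ h) (BE _ _ (on_pencilN h)).
rewrite !(hornerD, hornerN, hornerM, horner_exp) (esym h : (pencil_disc x3 y3).[s] = _).
by ring.
Qed.

Lemma pencil_curve s u : on_pencil s u ->
  pencil_ynum s u ^+ 2 =
    pencil_den s u * pencil_num s u * (pencil_num s u ^+ 2 - pencil_den s u ^+ 2).
Proof.
move=> h; rewrite /pencil_ynum /pencil_num /pencil_den.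
transitivity (c ^+ 2 * (pencil_y s u ^+ 2) * W.[pencil_x s u] ^+ 2 * B.[pencil_x s (- u)] ^+ 4).
  by ring.
by rewrite (pencil_y_sqr P3_on h) ode; ring.
Qed.

(** Let a = a0 + u a1 and b = b0 + u b1.  If a1 is not 0, the third point of the
chord of the two images has coordinates rational in s, so it has a constant
abscissa k by [rational_point_const]; the chord is y = (S / M) x + T / M^2, and
the last three equations are Vieta's formulas for it, multiplied by powers of M.
If a1 = 0 the two images have the same abscissa, so b0 or b1 is 0.  If b1 were 0
the image would be rational in s, hence constant, which it is not; so b0 = 0 and
the two images are opposite. *)
Lemma pencil_dichotomy :
  (forall s u, on_pencil s u ->
     pencil_num s u = pencil_num s (- u) /\ pencil_ynum s u = - pencil_ynum s (- u)) \/
  (exists k : C, exists S T : {poly C}, forall s u, on_pencil s u ->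
     [/\ pencil_ynum s u = S.[s] * pencil_num s u + T.[s],
         S.[s] ^+ 2 = pencil_den s u * (k * pencil_den s u + pencil_num s u + pencil_num s (- u)),
         pencil_den s u * (pencil_num s u * pencil_num s (- u)
                     + k * pencil_den s u * (pencil_num s u + pencil_num s (- u)))
           = - (pencil_den s u ^+ 3 + 2 * S.[s] * T.[s])
       & k * pencil_den s u ^+ 2 * pencil_num s u * pencil_num s (- u) = T.[s] ^+ 2]).
Proof.
have [a0 [a1 aE]] : pencil_fun x3 y3 pencil_num.
  by apply: pencil_funM; [|apply: (@pencil_fun_conj _ _ _ (fun s u => B.[pencil_x s u]))];
    exact: pencil_horner.
have [b0 [b1 bE]] : pencil_fun x3 y3 pencil_ynum.
  apply: pencil_funM; last first.
    apply: (@pencil_fun_conj _ _ _ (fun s u => B.[pencil_x s u] ^+ 2)).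
    by apply: (@pencil_funM _ _ _ (fun s u => B.[pencil_x s u]) (fun s u => B.[pencil_x s u]));
      exact: pencil_horner.
  apply: pencil_funM; last exact: pencil_horner.
  apply: (@pencil_funM _ _ _ (fun _ _ => c)); last exact: pencil_fun_y.
  by exists c%:P, 0 => s u _; rewrite hornerC horner0 mulr0 addr0.
have [D DE] : exists D, D = pencil_disc x3 y3 by exists (pencil_disc x3 y3).
have hD s u : on_pencil s u -> D.[s] = u ^+ 2 by rewrite DE => ->.
have [M ME] := pencil_den_poly.
have [m m0 mP] := pencil_horner_neq0 P3_on B_neq0.
have M0 : M != 0.
  have /closed_nonrootP[s ms] := m0.
  have [u hu] := on_pencil_ex x3 y3 s.
  apply/eqP => e; have := ME _ _ hu; rewrite e horner0; apply/eqP.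
  by rewrite mulf_neq0 //; apply: mP ms => //; exact: on_pencilN.
have ev (p q : {poly C}) s : p = q -> p.[s] = q.[s] by move=> ->.
have hEs := (horner_exp, hornerD, hornerN, hornerM, hornerZ, hornerX, hornerC).
have sqE s u : on_pencil s u -> (b0.[s] + u * b1.[s]) ^+ 2 =
   M.[s] * (a0.[s] + u * a1.[s]) * ((a0.[s] + u * a1.[s]) ^+ 2 - M.[s] ^+ 2).
  by move=> h; rewrite -aE // -bE // -(ME _ _ h) pencil_curve.
have [I1 I2] : b0 ^+ 2 + D * b1 ^+ 2
     - M * (a0 ^+ 3 + 3%:P * a0 * D * a1 ^+ 2 - M ^+ 2 * a0) = 0 /\
   2%:P * b0 * b1 - M * (3%:P * a0 ^+ 2 * a1 + D * a1 ^+ 3 - M ^+ 2 * a1) = 0.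
  apply: (@pencil_eq0 _ x3 y3 _ _ 1); rewrite ?oner_neq0 // => s u h _.
  have e := sqE _ _ h; rewrite !hEs (hD _ _ h).
  transitivity ((b0.[s] + u * b1.[s]) ^+ 2 -
    M.[s] * (a0.[s] + u * a1.[s]) * ((a0.[s] + u * a1.[s]) ^+ 2 - M.[s] ^+ 2)).
    by ring.
  by rewrite e subrr.
have [a10|a1n0] := eqVneq a1 0.
  left; suff b00 : b0 = 0.
    move=> s u h; have hN := on_pencilN h.
    rewrite (aE _ _ h) (aE _ _ hN) (bE _ _ h) (bE _ _ hN) a10 b00 horner0.
    by split; ring.
  move/eqP: I2; rewrite a10 !(mulr0, expr0n) /= !(mulr0, addr0, subr0).
  rewrite -mulrA mulf_eq0 polyC_eq0 pnatr_eq0 /= mulf_eq0 => /orP[/eqP//|/eqP b10].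
  have I3 : b0 ^+ 2 = a0 * M * (a0 ^+ 2 - M ^+ 2).
    apply/eqP; rewrite -subr_eq0 -I1 a10 b10; apply/eqP; ring.
  have [k kE] := rational_point_const M0 I3.
  have AkB : A - k *: B != 0.
    rewrite -size_poly_gt0 size_polyDl ?size_AB // size_polyN.
    by rewrite ltnS size_scale_leq.
  have [m' m'0 m'P] := pencil_horner_neq0 P3_on AkB.
  have /closed_nonrootP[s] : m * m' != 0 by rewrite mulf_neq0.
  rewrite rootM negb_or => /andP[ms m's].
  have [u hu] := on_pencil_ex x3 y3 s.
  have := m'P _ _ hu m's; rewrite hornerD hornerN hornerZ subr_eq0 => /eqP[].
  apply: (mulIf (mP _ _ (on_pencilN hu) ms)).
  rewrite -/(pencil_num s u) aE // a10 horner0 mulr0 addr0 kE hornerZ -(ME _ _ hu).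
  by rewrite /pencil_den mulrA.
right.
have [E EE] : exists E, E = M * a1 by exists (M * a1).
have E0 : E != 0 by rewrite EE mulf_neq0.
(* The third intersection of the chord with the curve is (Z / E^2, V / E^3). *)
have [Z ZE] : exists Z, Z = b1 ^+ 2 - 2%:P * a0 * M * a1 ^+ 2 by eexists.
have [V VE] : exists V, V = b1 * Z + (b0 * a1 - b1 * a0) * M * a1 ^+ 2 by eexists.
have generic s : E.[s] != 0 ->
  exists S T x n, [/\ b1.[s] = S * M.[s] * a1.[s],
   b0.[s] = S * a0.[s] * M.[s] + T * M.[s] ^+ 2,
   S ^+ 2 = x + 2 * (a0.[s] / M.[s]),
   n * M.[s] ^+ 2 = a0.[s] ^+ 2 - D.[s] * a1.[s] ^+ 2 &
   [/\ n + x * (2 * (a0.[s] / M.[s])) = - 1 - 2 * S * T & n * x = T ^+ 2]].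
  rewrite EE hornerM mulf_eq0 negb_or => /andP[Ms as1].
  have := ev _ _ s I1; have := ev _ _ s I2.
  rewrite horner0 !hEs => I2s I1s.
  have as1' : a1.[s] / M.[s] != 0 by rewrite mulf_neq0 // invr_eq0.
  have := @chord_third_point _ (a0.[s] / M.[s]) _ (b0.[s] / M.[s] ^+ 2)
    (b1.[s] / M.[s] ^+ 2) D.[s] as1'.
  case.
  - apply/eqP; rewrite -subr_eq0; apply/eqP.
    transitivity (0 / M.[s] ^+ 4); last by rewrite mul0r.
    by rewrite -I1s; field.
  - apply/eqP; rewrite -subr_eq0; apply/eqP.
    transitivity (0 / M.[s] ^+ 4); last by rewrite mul0r.
    by rewrite -I2s; field.
  set S := _ / (a1.[s] / _); set T := _ - S * _; set x := _ - 2 * _.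
  move=> H1 H2; exists S, T, x, ((a0.[s] / M.[s]) ^+ 2 - D.[s] * (a1.[s] / M.[s]) ^+ 2).
  split=> //.
  - by rewrite /S; field; rewrite Ms.
  - by rewrite /T; field.
  - by rewrite /x; ring.
  - by field.
have VE2 : (V * E) ^+ 2 = Z * E ^+ 2 * (Z ^+ 2 - (E ^+ 2) ^+ 2).
  apply/eqP; rewrite -subr_eq0; apply/eqP.
  apply: (poly_eq0_generic E0) => s Es.
  have [S [T [x [n [eb1 eb0 eS en [H1 H2]]]]]] := generic s Es.
  have Ms : M.[s] != 0 by move: Es; rewrite EE hornerM mulf_eq0 negb_or => /andP[].
  have Es' : E.[s] = M.[s] * a1.[s] by rewrite EE hornerM.
  have Zs : Z.[s] = x * E.[s] ^+ 2.
    rewrite Es' ZE !hEs eb1.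
    transitivity (S ^+ 2 * (M.[s] * a1.[s]) ^+ 2 - 2 * a0.[s] * M.[s] * a1.[s] ^+ 2).
      by ring.
    by rewrite eS; field.
  have Vs : V.[s] = (S * x + T) * E.[s] ^+ 3.
    by rewrite VE hornerD hornerM Zs Es' !hEs eb1 eb0; ring.
  have cub : (S * x + T) ^+ 2 = x ^+ 3 - x.
    transitivity (S ^+ 2 * x ^+ 2 + (2 * S * T) * x + T ^+ 2); first by ring.
    have -> : 2 * S * T = - 1 - (n + x * (2 * (a0.[s] / M.[s]))) by rewrite H1; ring.
    by rewrite eS -H2; ring.
  rewrite !hEs Zs Vs.
  transitivity (E.[s] ^+ 8 * ((S * x + T) ^+ 2 - (x ^+ 3 - x))); first by ring.
  by rewrite cub subrr mulr0.
have [k kE] := rational_point_const (expf_neq0 2 E0) VE2.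
have b1E : b1 ^+ 2 = a1 ^+ 2 * (M * (k *: M + 2%:P * a0)).
  apply/eqP; rewrite -subr_eq0; apply/eqP.
  transitivity (Z - k *: E ^+ 2); last by rewrite kE subrr.
  by rewrite ZE EE -!mul_polyC; ring.
(* The slope b1 / (M a1) of the chord is S / M with S a polynomial, so that the
   equations of the chord also hold where a1 vanishes. *)
have /dvdpP[S SE] : a1 %| b1.
  by rewrite -(@dvdp_pexp2r _ _ _ 2) // b1E dvdp_mulr.
have [T TE] : exists T, T = b0 - S * a0 by eexists.
have S2 : S ^+ 2 = M * (k *: M + 2%:P * a0).
  by apply: (mulIf (expf_neq0 2 a1n0)); rewrite -exprMn -SE b1E mulrC.
have [J1 J2] : M * (a0 ^+ 2 - D * a1 ^+ 2 + 2%:P * (k *: M) * a0) + (M ^+ 3 + 2%:P * S * T) = 0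
    /\ (k *: M ^+ 2) * (a0 ^+ 2 - D * a1 ^+ 2) - T ^+ 2 = 0.
  suff key s : E.[s] != 0 ->
     (M * (a0 ^+ 2 - D * a1 ^+ 2 + 2%:P * (k *: M) * a0) + (M ^+ 3 + 2%:P * S * T)).[s] = 0
    /\ ((k *: M ^+ 2) * (a0 ^+ 2 - D * a1 ^+ 2) - T ^+ 2).[s] = 0.
    by split; apply: (poly_eq0_generic E0) => s Es; case: (key s Es).
  move=> Es.
  have [S' [T' [x [n [eb1 eb0 eS en [H1 H2]]]]]] := generic s Es.
  have [Ms as1] : M.[s] != 0 /\ a1.[s] != 0.
    by move: Es; rewrite EE hornerM mulf_eq0 negb_or => /andP[].
  have Ss : S.[s] = S' * M.[s].
    by apply: (mulIf as1); rewrite -eb1 SE hornerM.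
  have Ts : T.[s] = T' * M.[s] ^+ 2.
    by rewrite TE !hEs Ss eb0; ring.
  have xk : x = k.
    have := ev _ _ s S2; rewrite !hEs Ss exprMn eS => e.
    apply: (mulIf (expf_neq0 2 Ms)).
    transitivity ((x + 2 * (a0.[s] / M.[s])) * M.[s] ^+ 2 - 2 * a0.[s] * M.[s]).
      by field.
    by rewrite e; ring.
  rewrite xk in H1 H2; rewrite !hEs Ss Ts -en; split.
    transitivity (M.[s] ^+ 3 * ((n + k * (2 * (a0.[s] / M.[s]))) - (- 1 - 2 * S' * T'))).
      by field.
    by rewrite H1 subrr mulr0.
  transitivity (M.[s] ^+ 4 * (n * k - T' ^+ 2)); last by rewrite H2 subrr mulr0.
  by ring.
exists k, S, T => s u h; have hN := on_pencilN h.
rewrite (ME _ _ h) (aE _ _ h) (aE _ _ hN) (bE _ _ h).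
have := ev _ _ s S2; have := ev _ _ s J1; have := ev _ _ s J2.
rewrite horner0 !hEs (hD _ _ h) => J2s J1s S2s; split.
- by rewrite TE SE !hEs; ring.
- by rewrite S2s; ring.
- apply/eqP; rewrite -subr_eq0 -J1s; apply/eqP; ring.
- apply/eqP; rewrite -subr_eq0 -J2s; apply/eqP; ring.
Qed.

(** At the limit where the first moving point is at infinity, in the first case
of [pencil_dichotomy] the second image must be at infinity as well; in the second
case Vieta's formulas become (A(x3) - k B(x3))^2 = 0. *)
Lemma pencil_sum :
  (B.[x3] = 0 /\ forall s u, on_pencil s u ->
     pencil_num s u = pencil_num s (- u) /\ pencil_ynum s u = - pencil_ynum s (- u)) \/
  (B.[x3] != 0 /\ exists k : C, exists S T : {poly C}, A.[x3] = k * B.[x3] /\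
    forall s u, on_pencil s u ->
     [/\ pencil_ynum s u = S.[s] * pencil_num s u + T.[s],
         S.[s] ^+ 2 = pencil_den s u * (k * pencil_den s u + pencil_num s u + pencil_num s (- u)),
         pencil_den s u * (pencil_num s u * pencil_num s (- u)
                     + k * pencil_den s u * (pencil_num s u + pencil_num s (- u)))
           = - (pencil_den s u ^+ 3 + 2 * S.[s] * T.[s])
       & k * pencil_den s u ^+ 2 * pencil_num s u * pencil_num s (- u) = T.[s] ^+ 2]).
Proof.
have [u [hu zlim xlim]] := pencil_limit x3 y3.
have FF : Filter (@cinfty C) by exact: _.
pose n := size B; pose z s := (pencil_x s (u s))^-1; pose x2 s := pencil_x s (- u s).
have lA0 : A`_n != 0.
  by have := lead_coef_eq0 A; rewrite lead_coefE size_AB /= => ->; rewrite -size_poly_gt0 size_AB.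
have B0 : B`_n = 0 by rewrite nth_default.
have limA := cvg_horner (FF := FF) (p := revp A n) zlim.
have limB := cvg_horner (FF := FF) (p := revp B n) zlim.
have limA2 := cvg_horner (FF := FF) (p := A) xlim.
have limB2 := cvg_horner (FF := FF) (p := B) xlim.
rewrite revp0 in limA; rewrite revp0 B0 in limB.
have [m m0 mP] := pencil_horner_neq0 P3_on (mulf_neq0 B_neq0 (negbT (polyX_eq0 C))).
have near_m := near_cinfty_horner_neq0 m0.
have nz s : m.[s] != 0 -> [/\ z s != 0, B.[pencil_x s (u s)] != 0 & B.[x2 s] != 0].
  move=> ms; have := mP _ _ (hu s) ms; have := mP _ _ (on_pencilN (hu s)) ms.
  rewrite !hornerM !mulf_eq0 !negb_or => /andP[-> _] /andP[-> xs]; split=> //.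
  by rewrite invr_eq0 -(hornerX (pencil_x s (u s))).
have revA s : z s != 0 -> (revp A n).[z s] = z s ^+ n * A.[pencil_x s (u s)].
  by move=> zs; rewrite revp_horner ?invrK ?size_AB.
have revB s : z s != 0 -> (revp B n).[z s] = z s ^+ n * B.[pencil_x s (u s)].
  by move=> zs; rewrite revp_horner ?invrK // ltnW.
case: pencil_dichotomy => [h|[k [S [T h]]]].
  left; split=> //.
  apply: (mulfI lA0); rewrite mulr0.
  have lim : (revp A n).[z s] * B.[x2 s] - A.[x2 s] * (revp B n).[z s] @[s --> cinfty]
      --> A`_n * B.[x3] - A.[x3] * 0.
    by apply: cvgB; apply: cvgM.
  rewrite mulr0 subr0 in lim; apply: (cvg_near0_eq lim).
  apply: filterS near_m => s /nz[zs _ _].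
  have [e _] := h _ _ (hu s); rewrite revA // revB //.
  move: e; rewrite /pencil_num opprK -/(x2 s) => e.
  by rewrite mulrCA -!mulrA e; ring.
right.
have key : A.[x3] = k * B.[x3].
  apply/eqP; rewrite -subr_eq0 -sqrf_eq0; apply/eqP.
  apply: (mulfI (expf_neq0 2 lA0)); rewrite mulr0.
  pose G a b a' b' := (b * b' + a * a' + k * (a * b' + a' * b)) ^+ 2
    - 4 * k * (a * a') * (k * (b * b') + a * b' + a' * b).
  have lim : G (revp A n).[z s] (revp B n).[z s] A.[x2 s] B.[x2 s] @[s --> cinfty]
      --> G A`_n 0 A.[x3] B.[x3].
    have ck : (fun=> k) s @[s --> (@cinfty C)] --> k by exact: cvg_cst.
    have c4 : (fun=> 4) s @[s --> (@cinfty C)] --> (4 : C) by exact: cvg_cst.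
    have c1 := cvgD (FF := FF) (cvgD (FF := FF) (cvgM (FF := FF) limB limB2)
      (cvgM (FF := FF) limA limA2)) (cvgM (FF := FF) ck
        (cvgD (FF := FF) (cvgM (FF := FF) limA limB2) (cvgM (FF := FF) limA2 limB))).
    have c2 := cvgM (FF := FF) (cvgM (FF := FF) (cvgM (FF := FF) c4 ck)
        (cvgM (FF := FF) limA limA2))
      (cvgD (FF := FF) (cvgD (FF := FF) (cvgM (FF := FF) ck
        (cvgM (FF := FF) limB limB2)) (cvgM (FF := FF) limA limB2))
        (cvgM (FF := FF) limA2 limB)).
    exact: cvgB (cvgM c1 c1) c2.
  have -> : A`_n ^+ 2 * (A.[x3] - k * B.[x3]) ^+ 2 = G A`_n 0 A.[x3] B.[x3].
    by rewrite /G; ring.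
  apply: (cvg_near0_eq lim); apply: filterS near_m => s /nz[zs b1 b2].
  have [_ e1 e2 e3] := h _ _ (hu s); rewrite revA // revB //.
  move: e1 e2 e3; rewrite /pencil_num /pencil_den opprK -/(x2 s).
  move: (pencil_x s (u s)) (x2 s) b1 b2 => t1 t2 b1 b2 e1 e2 e3.
  set M := B.[t1] * B.[t2] in e1 e2 e3.
  have M0 : M != 0 by rewrite mulf_neq0.
  apply: (mulfI (expf_neq0 4 M0)); rewrite mulr0.
  pose E := A.[t1] * B.[t2] * (A.[t2] * B.[t1])
     + k * M * (A.[t1] * B.[t2] + A.[t2] * B.[t1]).
  transitivity (z s ^+ n ^+ 2 * ((M ^+ 3 + M * E) ^+ 2 - 4 *
      (M * (k * M + A.[t1] * B.[t2] + A.[t2] * B.[t1])) *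
      (k * M ^+ 2 * (A.[t1] * B.[t2]) * (A.[t2] * B.[t1])))).
    by rewrite /G /E /M; ring.
  by rewrite -e1 /E e2 e3; ring.
split; last by exists k, S, T.
apply/eqP => b3; have := coprimep_root AB_coprime (x := x3).
by rewrite /root key b3 mulr0 eqxx => /(_ isT).
Qed.

End ImagePencil.

Definition image_x x := A.[x] / B.[x].

Definition image_y x y := c * y * W.[x] / B.[x] ^+ 2.

Lemma image_on x y : y ^+ 2 = x ^+ 3 - x -> B.[x] != 0 ->
  image_y x y ^+ 2 = image_x x ^+ 3 - image_x x.
Proof.
move=> on b0; rewrite /image_y /image_x.
transitivity (c ^+ 2 * y ^+ 2 * W.[x] ^+ 2 / B.[x] ^+ 4); first by field.
by rewrite on ode; field.
Qed.

(** A point mapped to infinity is in the kernel: the images of the two points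
collinear with it are opposite. *)
Lemma kernel_opp s t x1 x2 x3 : collinear s t x1 x2 x3 -> B.[x3] = 0 ->
  A.[x1] * B.[x2] = A.[x2] * B.[x1] /\
  c * (s * x1 + t) * W.[x1] * B.[x2] ^+ 2 =
    - (c * (s * x2 + t) * W.[x2] * B.[x1] ^+ 2).
Proof.
move=> h b3; have [on a1 a2 o1 o2] := collinear_pencil h.
have P3_on := collinear_on h.
have [[_ /(_ _ _ on)]|[/eqP//]] :=
  pencil_sum P3_on.
by rewrite /pencil_num /pencil_ynum opprK a1 a2 o1 o2.
Qed.

(** By [pencil_sum] the chord of the images of the first two points contains the
point of abscissa [image_x x3] and ordinate [image_y x3 _] up to a sign, which is
the same for all lines through the third point since it is a quotient of
polynomials in s.  To determine it, the tangent at the third point is taken: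
there, one of the moving points is the third point itself.  If the other
intersection x' of the tangent is in the kernel, [kernel_opp] shows that the
ordinate is 0. *)
Lemma image_collinear s t x1 x2 x3 : collinear s t x1 x2 x3 ->
  B.[x1] != 0 -> B.[x2] != 0 -> B.[x3] != 0 ->
  exists S T, [/\ collinear S T (image_x x1) (image_x x2) (image_x x3),
    image_y x1 (s * x1 + t) = S * image_x x1 + T,
    image_y x2 (s * x2 + t) = S * image_x x2 + T &
    image_y x3 (s * x3 + t) = S * image_x x3 + T].
Proof.
move=> h b1 b2 b3; have P3_on := collinear_on h.
case: (pencil_sum P3_on) => [[/eqP]|[_]].
  by rewrite (negPf b3).
move=> [k [S [T [kE rel]]]].
have [M ME] := pencil_den_poly x3 (s * x3 + t).
have kX : image_x x3 = k by rewrite /image_x kE mulfK.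
set y3 := s * x3 + t in P3_on rel ME *.
have third r u : on_pencil x3 y3 r u ->
    (S.[r] * k * M.[r] + T.[r]) ^+ 2 = M.[r] ^+ 4 * (k ^+ 3 - k).
  move=> hu; have [_ e1 e2 e3] := rel _ _ hu; rewrite (ME _ _ hu) in e1 e2 e3.
  transitivity (S.[r] ^+ 2 * (k * M.[r]) ^+ 2 + (2 * S.[r] * T.[r]) * (k * M.[r])
     + T.[r] ^+ 2); first by ring.
  have -> : 2 * S.[r] * T.[r] = - (M.[r] ^+ 3 + M.[r] * (pencil_num x3 r u * pencil_num x3 r (- u)
    + k * M.[r] * (pencil_num x3 r u + pencil_num x3 r (- u)))).
    by rewrite e2; ring.
  by rewrite e1 -e3; ring.
have Y3_on := image_on P3_on b3; rewrite kX in Y3_on.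
pose P := S * k%:P * M + T; pose Q := (image_y x3 y3)%:P * M ^+ 2.
have PE r : P.[r] = S.[r] * k * M.[r] + T.[r].
  by rewrite hornerD !hornerM hornerC.
have QE r : Q.[r] = image_y x3 y3 * M.[r] ^+ 2 by rewrite hornerM hornerC horner_exp.
have P2 : P ^+ 2 = Q ^+ 2.
  apply/eqP; rewrite -subr_eq0; apply/eqP.
  apply: (@poly_eq0_generic _ _ 1); rewrite ?oner_neq0 // => r _.
  have [u hu] := on_pencil_ex x3 y3 r.
  rewrite hornerD hornerN !horner_exp PE QE (third _ _ hu) -Y3_on.
  by ring.
have PQ : P = Q.
  have /orP[/eqP//|/eqP PN] : (P == Q) || (P == - Q) by rewrite -eqf_sqr P2.
  suff Y0 : image_y x3 y3 = 0 by rewrite PN /Q Y0 mul0r oppr0.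
  have [y30|y3n0] := eqVneq y3 0; first by rewrite /image_y y30 mulr0 !mul0r.
  have /= := tangent_collinear two0 y3n0 P3_on.
  set r := _ / _; set x' := _ - x3 - x3 => tg.
  have [b'|b'] := eqVneq B.[x'] 0.
    have [_] := kernel_opp tg b'.
    have -> : r * x3 + (y3 - r * x3) = y3 by ring.
    move/eqP; rewrite -subr_eq0 opprK -mulr2n -mulr_natl mulf_eq0 (negPf two0) /=.
    by rewrite mulf_eq0 expf_eq0 (negPf b3) orbF /image_y => /eqP ->; rewrite mul0r.
  have [on a1 a2 o1 o2] := collinear_pencil (collinear_rot tg).
  have yE : r * x3 + (y3 - r * x3) = y3 by ring.
  rewrite yE in on o1 o2.
  move: (rel _ _ on) (ME _ _ on) => [e _ _ _].
  move: e; rewrite /pencil_ynum /pencil_num /pencil_den a1 a2 o1 kE => e ME'.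
  have Mr0 : M.[r] != 0 by rewrite -ME' mulf_neq0.
  have QP : Q.[r] = P.[r].
    rewrite PE QE -ME' /image_y.
    transitivity (c * y3 * W.[x3] * B.[x'] ^+ 2); first by field.
    by rewrite e; ring.
  have : 2 * Q.[r] = 0.
    by rewrite mulr_natl mulr2n {1}QP PN hornerN addNr.
  move/eqP; rewrite mulf_eq0 (negPf two0) /= QE mulf_eq0 expf_eq0 (negPf Mr0) orbF.
  by move/eqP.
have [on a1 a2 o1 o2] := collinear_pencil h.
have hM := ME _ _ on; have [e1 e2 e3 e4] := rel _ _ on.
have [e1' _ _ _] := rel _ _ (on_pencilN on).
move: e1 e2 e3 e4 e1'; rewrite hM /pencil_num /pencil_ynum opprK a1 a2 o1 o2 => e1 e2 e3 e4 e1'.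
have M12 : M.[s] = B.[x1] * B.[x2] by rewrite -hM /pencil_den a1 a2.
have M0 : M.[s] != 0 by rewrite M12 mulf_neq0.
have iX1 : A.[x1] * B.[x2] = image_x x1 * M.[s] by rewrite M12 /image_x; field.
have iX2 : A.[x2] * B.[x1] = image_x x2 * M.[s] by rewrite M12 /image_x; field.
have iY1 : c * (s * x1 + t) * W.[x1] * B.[x2] ^+ 2 = image_y x1 (s * x1 + t) * M.[s] ^+ 2.
  by rewrite M12 /image_y; field.
have iY2 : c * (s * x2 + t) * W.[x2] * B.[x1] ^+ 2 = image_y x2 (s * x2 + t) * M.[s] ^+ 2.
  by rewrite M12 /image_y; field.
rewrite iX1 iX2 in e2 e3 e4; rewrite iX1 iY1 in e1; rewrite iX2 iY2 in e1'.
exists (S.[s] / M.[s]), (T.[s] / M.[s] ^+ 2); split.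
- rewrite kX; split.
  + by rewrite expr_div_n e2; field.
  + apply: (mulIf (expf_neq0 3 M0)); rewrite mul0r.
    transitivity (M.[s] * (image_x x1 * M.[s] * (image_x x2 * M.[s]) +
       k * M.[s] * (image_x x1 * M.[s] + image_x x2 * M.[s])) + (M.[s] ^+ 3 + 2 * S.[s] * T.[s])).
      by field.
    by rewrite e3 addNr.
  + by rewrite expr_div_n -e4; field.
- by apply: (mulIf (expf_neq0 2 M0)); rewrite e1; field.
- by apply: (mulIf (expf_neq0 2 M0)); rewrite e1'; field.
- by apply: (mulIf (expf_neq0 2 M0)); rewrite -QE -PQ PE kX; field.
Qed.

(** * The map on the curve *)

(** As A and B are coprime, the poles of A / B are the roots of B. *)
Definition point_image (P : Defs.point C) : Defs.point C :=
  if P is Aff x y then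
    if B.[x] == 0 then Inf C else Aff (image_x x) (image_y x y)
  else Inf C.

Lemma onE1_point_image P : onE1 P -> onE1 (point_image P).
Proof.
case: P => [//|x y] /= /eqP on; case: ifPn => //= b0.
by apply/eqP; apply: (image_on).
Qed.

Definition phi (P : E1 C) : E1 C := MkE1 (onE1_point_image (E1P P)).

Lemma num_neq0 x : B.[x] = 0 -> A.[x] != 0.
Proof.
by move=> b0; apply: (@coprimep_root _ B); rewrite 1?coprimep_sym //; apply/rootP.
Qed.

Lemma image_yN x y : image_y x (- y) = - image_y x y.
Proof. by rewrite /image_y mulrN !mulNr. Qed.

Lemma kernel_image s t x1 x2 x3 : collinear s t x1 x2 x3 -> B.[x3] = 0 ->
  point_image (Aff x2 (- (s * x2 + t))) = point_image (Aff x1 (s * x1 + t)).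
Proof.
move=> h b3; have [eA eY] := kernel_opp h b3.
rewrite /=; have [b1|b1] := eqVneq B.[x1] 0.
  move/eqP: eA; rewrite b1 mulr0 mulf_eq0 (negPf (num_neq0 b1)) /= => /eqP ->.
  by rewrite eqxx.
have [b2|b2] := eqVneq B.[x2] 0.
  move/esym/eqP: eA; rewrite b2 mulr0 mulf_eq0 (negPf (num_neq0 b2)) /=.
  by rewrite (negPf b1).
congr Aff.
  by rewrite /image_x; apply: (canRL (mulfK b1)); rewrite mulrAC -eA mulfK.
rewrite image_yN /image_y; apply: (mulIf (expf_neq0 2 b1)); apply: (mulIf (expf_neq0 2 b2)).
rewrite divfK ?expf_neq0 // eY; field; exact: b2.
Qed.

Lemma image_padd P Q : onE1 P -> onE1 Q ->
  point_image (padd P Q) = padd (point_image P) (point_image Q).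
Proof.
case: P => [|x1 y1]; case: Q => [|x2 y2] //.
  by move=> _ _ /=; case: ifP.
move=> /eqP on1 /eqP on2.
case: (collinear_or_opp two0 on1 on2) => [[x12 y12]|[s [t [x3 [h -> ->]]]]].
  by rewrite -x12 y12 padd_opp /point_image; case: ifPn => // b1; rewrite image_yN padd_opp.
rewrite (padd_collinear two0 h).
have [b3|b3] := eqVneq B.[x3] 0.
  rewrite -(kernel_image h b3) {1}/point_image b3 eqxx /point_image.
  by case: ifPn => // b2; rewrite image_yN -{2}(opprK (image_y x2 _)) padd_opp.
have [b1|b1] := eqVneq B.[x1] 0.
  by rewrite (kernel_image (collinear_rot h) b1) {2}/point_image b1 eqxx.
have [b2|b2] := eqVneq B.[x2] 0.
  rewrite (kernel_image (collinear_swap (collinear_rot (collinear_rot h))) b2).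
  by rewrite {3}/point_image b2 eqxx; case: (point_image _).
rewrite /point_image (negPf b1) (negPf b2) (negPf b3) image_yN.
have [S [T [hST -> -> ->]]] := image_collinear h b1 b2 b3.
by rewrite (padd_collinear two0 hST).
Qed.

Lemma phi_morph : {morph phi : P Q / E1add P Q}.
Proof.
by move=> P Q; apply: E1val_inj; apply: image_padd; exact: E1P.
Qed.

(** Nothing is asked where all three vanish: this makes the condition stable under
multiplication by a function with zeros. *)
Definition represents (f0 f1 f2 : C) (Q : Defs.point C) :=
  (f0 != 0) || (f1 != 0) || (f2 != 0) ->
  exists2 k, k != 0 & [/\ f0 = k * hcoord Q (@Ordinal 3 0 isT),
    f1 = k * hcoord Q (@Ordinal 3 1 isT) & f2 = k * hcoord Q (@Ordinal 3 2 isT)].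

Lemma represents_scale l f0 f1 f2 Q : represents f0 f1 f2 Q ->
  represents (l * f0) (l * f1) (l * f2) Q.
Proof.
move=> h; have [->|l0] := eqVneq l 0.
  by rewrite /represents !mul0r eqxx.
rewrite /represents !mulf_eq0 (negPf l0) /= => /h[k k0 [-> -> ->]].
by exists (l * k); rewrite ?mulf_neq0 // !mulrA.
Qed.

Lemma represents_regular x y : y ^+ 2 = x ^+ 3 - x ->
  represents (A.[x] * B.[x]) (c * y * W.[x]) (B.[x] ^+ 2) (point_image (Aff x y)).
Proof.
move=> on; rewrite /represents /=; have [b0|b0] := eqVneq B.[x] 0.
  rewrite b0 mulr0 expr0n eqxx /= orbF => w0.
  by exists (c * y * W.[x]) => //; rewrite /= !mulr0 mulr1.
move=> _; exists (B.[x] ^+ 2); first by rewrite expf_neq0.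
by rewrite /= /image_x /image_y; split; field.
Qed.

(** These are the coordinates (A B : c y W : B^2) multiplied by c y W / B: by the
differential equation (c y W)^2 / B = A (A^2 - B^2) is a polynomial, which does
not vanish at the roots of B. *)
Lemma represents_polar x y : y ^+ 2 = x ^+ 3 - x ->
  represents (c * y * W.[x] * A.[x]) (A.[x] * (A.[x] ^+ 2 - B.[x] ^+ 2))
    (c * y * W.[x] * B.[x]) (point_image (Aff x y)).
Proof.
move=> on; have sq : (c * y * W.[x]) ^+ 2 = A.[x] * B.[x] * (A.[x] ^+ 2 - B.[x] ^+ 2).
  by rewrite -ode -on; ring.
rewrite /represents /=; have [b0|b0] := eqVneq B.[x] 0.
  have -> : c * y * W.[x] = 0.
    by apply/eqP; rewrite -sqrf_eq0 sq b0 mulr0 mul0r.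
  rewrite b0 !mul0r expr0n subr0 eqxx /= orbF => w0.
  by exists (A.[x] * A.[x] ^+ 2) => //; rewrite /= !mulr0 mulr1.
have [w0|w0] := eqVneq (c * y * W.[x]) 0.
  have -> : A.[x] * (A.[x] ^+ 2 - B.[x] ^+ 2) = 0.
    by apply: (mulfI b0); rewrite mulr0 mulrA (mulrC B.[x]) -sq w0 expr0n.
  by rewrite w0 !mul0r eqxx.
move=> _; exists (c * y * W.[x] * B.[x]); first by rewrite mulf_neq0.
split=> /=; rewrite ?mulr1 //; first by rewrite /image_x; field.
transitivity ((c * y * W.[x]) ^+ 2 / B.[x]); first by rewrite sq; field.
by rewrite /image_y; field.
Qed.

Definition chart (P : E1 C) := exists d F0 F1 F2,
  [/\ [/\ F0 \is ishomog1 d (@mdeg 3), F1 \is ishomog1 d mdeg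
         & F2 \is ishomog1 d mdeg],
      [|| meval (@hcoord C P) F0 != 0, meval (hcoord P) F1 != 0
        | meval (hcoord P) F2 != 0]
    & forall Q : E1 C, represents (meval (hcoord Q) F0) (meval (hcoord Q) F1)
        (meval (hcoord Q) F2) (point_image Q)].

Lemma algebraic_of_charts : (forall P, chart P) -> algebraic_map phi.
Proof.
move=> charts P; have [d [F0 [F1 [F2 [[h0 h1 h2] nz rep]]]]] := charts P.
exists d, (fun i : 'I_3 => [:: F0; F1; F2]`_i); split.
- by case=> [[|[|[|]]]].
- case/or3P: nz => nz; [exists (@Ordinal 3 0 isT)|exists (@Ordinal 3 1 isT)|
    exists (@Ordinal 3 2 isT)]; exact: nz.
move=> Q [i nzi]; have [|k k0 [e0 e1 e2]] := rep Q.
  by move: nzi; case: i => [[|[|[|]]]] //= _ ->; rewrite ?orbT.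
exists k => // -[[|[|[|//]]] hi] /=.
- by rewrite e0; congr (_ * hcoord _ _); apply: val_inj.
- by rewrite e1; congr (_ * hcoord _ _); apply: val_inj.
- by rewrite e2; congr (_ * hcoord _ _); apply: val_inj.
Qed.

Lemma homogenize_homog (p : {poly C}) d e (G H : mpoly 3 C) :
   G \is ishomog1 e mdeg -> H \is ishomog1 e mdeg ->
  homogenize p d G H \is ishomog1 (e * d) mdeg.
Proof.
move=> hG hH; apply: rpred_sum => k _; apply: rpredZ.
have -> : (e * d = e * k + e * (d - k))%N by rewrite -mulnDr subnKC // -ltnS.
by apply: dhomogM; apply: dhomogMn.
Qed.

Lemma meval_homogenize (p : {poly C}) d (G H : mpoly 3 C) v r :
  (size p <= d.+1)%N -> meval v G = r * meval v H ->
  meval v (homogenize p d G H) = meval v H ^+ d * p.[r].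
Proof.
move=> sp hr; rewrite -homogenize_eval // /homogenize rmorph_sum.
by apply: eq_bigr => k _; rewrite /= mevalZ rmorphM !rmorphXn /= hr.
Qed.

Lemma meval_homogenize_infty (p : {poly C}) d (G H : mpoly 3 C) v :
   meval v H = 0 ->
  meval v (homogenize p d G H) = p`_d * meval v G ^+ d.
Proof.
move=> h0; rewrite /homogenize rmorph_sum big_ord_recr /= big1 ?add0r => [|k _].
  by rewrite mevalZ rmorphM !rmorphXn /= subnn expr0 mulr1.
by rewrite mevalZ rmorphM !rmorphXn /= h0 expr0n subn_eq0 leqNgt ltn_ord mulr0 mulr0.
Qed.

Let X : mpoly 3 C := mpolyX C (mnm1 (@Ordinal 3 0 isT)).
Let Y : mpoly 3 C := mpolyX C (mnm1 (@Ordinal 3 1 isT)).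
Let Z : mpoly 3 C := mpolyX C (mnm1 (@Ordinal 3 2 isT)).

Let homX : X \is ishomog1 1 mdeg.
Proof. by rewrite dhomogX; apply/eqP; exact: mdeg1. Qed.
Let homY : Y \is ishomog1 1 mdeg.
Proof. by rewrite dhomogX; apply/eqP; exact: mdeg1. Qed.
Let homZ : Z \is ishomog1 1 mdeg.
Proof. by rewrite dhomogX; apply/eqP; exact: mdeg1. Qed.

Let evX (Q : Defs.point C) : meval (hcoord Q) X = hcoord Q (@Ordinal 3 0 isT).
Proof. by rewrite mevalXU. Qed.
Let evY (Q : Defs.point C) : meval (hcoord Q) Y = hcoord Q (@Ordinal 3 1 isT).
Proof. by rewrite mevalXU. Qed.
Let evZ (Q : Defs.point C) : meval (hcoord Q) Z = hcoord Q (@Ordinal 3 2 isT).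
Proof. by rewrite mevalXU. Qed.

Let homcY : c *: Y \is ishomog1 1 mdeg. Proof. exact: rpredZ. Qed.
Let evcY (Q : Defs.point C) :
  meval (hcoord Q) (c *: Y) = c * hcoord Q (@Ordinal 3 1 isT).
Proof. by rewrite mevalZ evY. Qed.

Let homXZ (p : {poly C}) d : homogenize p d X Z \is ishomog1 d mdeg.
Proof. by rewrite -[X in ishomog1 X]mul1n; exact: homogenize_homog. Qed.

Let evXZ_aff x y (p : {poly C}) d : (size p <= d.+1)%N ->
  meval (hcoord (Aff x y)) (homogenize p d X Z) = p.[x].
Proof.
move=> sp; rewrite (@meval_homogenize _ _ _ _ _ x) // ?evX ?evZ /= ?mulr1 //.
by rewrite expr1n mul1r.
Qed.

Let evXZ_infty (p : {poly C}) d :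
  meval (hcoord (Inf C)) (homogenize p d.+1 X Z) = 0.
Proof. by rewrite meval_homogenize_infty ?evX ?evZ //= expr0n mulr0. Qed.

(** At infinity, i.e. at (0 : 1 : 0), the affine coordinates are written as V / U
and y V / x^3 with U = x^2 and V = y^2 + x z: indeed z V = x^3 on the curve.  Then
the coordinates of [represents_polar] do not all vanish there. *)
Lemma chart_infty P : (size W < (size B).*2)%N -> E1val P = Inf C -> chart P.
Proof.
move=> size_W Pinf.
pose U : mpoly 3 C := X ^+ 2; pose V : mpoly 3 C := Y ^+ 2 + X * Z.
have homU : U \is ishomog1 2 mdeg by exact: (dhomogMn 2 homX).
have homV : V \is ishomog1 2 mdeg.
  by apply: rpredD; [exact: (dhomogMn 2 homY)|exact: (dhomogM homX homZ)].
have homYV : c *: (Y * V) \is ishomog1 3 mdeg.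
  by apply: rpredZ; exact: (dhomogM homY homV).
pose N : {poly C} := A * (A ^+ 2 - B ^+ 2).
have [b sB] : exists b, size B = b.+1.
  by exists (size B).-1; rewrite prednK // size_poly_gt0.
have sA : size A = b.+2 by rewrite size_AB sB.
have sW : (size W <= b.*2.+1)%N by move: size_W; rewrite sB doubleS ltnS.
(* The degree e of A (A^2 - B^2) has to be exact: the homogenization in that
   degree does not vanish at infinity. *)
pose e := (b * 3)%N.
have eE : (b + b.*2)%N = e by rewrite /e !mulnS muln0 addn0 -addnn.
have sAW : (size (A * W)%R <= e.+2)%N.
  apply: leq_trans (size_polyMleq _ _) _; rewrite sA /= addSn ltnS.
  by apply: leq_trans (leq_add (leqnn b) sW) _; rewrite addnS eE.
have sBW : (size (B * W)%R <= e.+1)%N.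
  apply: leq_trans (size_polyMleq _ _) _; rewrite sB /=.
  by apply: leq_trans (leq_add (leqnn b) sW) _; rewrite addnS eE.
have sN : size N = e.+4.
  have sA2 : size (A ^+ 2) = b.*2.+3.
    by rewrite expr2 size_mul -?size_poly_gt0 ?sA //= addSn addnS -addnn addnS.
  have sAB2 : size (A ^+ 2 - B ^+ 2) = b.*2.+3.
    rewrite size_polyDl ?sA2 // size_polyN expr2.
    apply: leq_ltn_trans (size_polyMleq _ _) _.
    by rewrite sB /= -addnn addnS !ltnS leqW.
  by rewrite size_mul -?size_poly_gt0 ?sAB2 ?sA //= addSn !addnS eE.
exists (2 * e.+3)%N, (X * (c *: (Y * V)) * homogenize (A * W) e.+1 V U),
  (homogenize N e.+3 V U), (X ^+ 3 * (c *: (Y * V)) * homogenize (B * W) e V U).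
split.
- split; [|exact: homogenize_homog|].
    have -> : (2 * e.+3 = 1 + 3 + 2 * e.+1)%N by rewrite !mulnS.
    by apply: dhomogM; [exact: dhomogM|exact: homogenize_homog].
  have -> : (2 * e.+3 = 3 + 3 + 2 * e)%N by rewrite !mulnS.
  apply: dhomogM; last exact: homogenize_homog.
  by apply: dhomogM => //; exact: (dhomogMn 3 homX).
- apply/or3P/Or32; rewrite Pinf meval_homogenize_infty; last first.
    by rewrite /U rmorphXn /= evX expr0n.
  rewrite /V mevalD rmorphXn mevalM /= evX evY evZ /= mul0r addr0 !expr1n mulr1.
  have := lead_coef_eq0 N; rewrite lead_coefE sN /= => ->.
  by rewrite -size_poly_gt0 sN.
case=> [[|x y] on].
  rewrite /represents !mevalM evX /= !mul0r eqxx orbF /= => n0.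
  by exists (meval (hcoord (Inf C)) (homogenize N e.+3 V U));
    rewrite //= !mulr0 mulr1.
have on' : y ^+ 2 = x ^+ 3 - x by apply/eqP.
have vU : meval (hcoord (Aff x y)) U = x ^+ 2 by rewrite rmorphXn /= evX.
have vV : meval (hcoord (Aff x y)) V = x * x ^+ 2.
  by rewrite mevalD rmorphXn mevalM /= evX evY evZ /= on'; ring.
have vUV : meval (hcoord (Aff x y)) V = x * meval (hcoord (Aff x y)) U.
  by rewrite vV vU.
rewrite !mevalM !mevalZ !mevalM.
rewrite (meval_homogenize sAW vUV) (meval_homogenize sBW vUV).
rewrite (meval_homogenize (eq_leq sN) vUV).
rewrite evX evY vV vU /= !hornerM hornerD hornerN !horner_exp.
have := represents_scale (l := (x ^+ 2) ^+ e.+3) (represents_polar on').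
by congr (represents _ _ _ _); rewrite !exprS; ring.
Qed.

(** Any degree larger than those of the given polynomials will do for the charts
at the finite points, as long as the homogenizations vanish at infinity. *)
Let degree_bound (ps : seq {poly C}) : exists n, forall p, p \in ps ->
  (size p <= n.+2)%N /\ (size p <= n.+3)%N.
Proof.
exists (\max_(p <- ps) size p)%N => p pin.
have h : (size p <= \max_(p <- ps) size p)%N.
  exact: (@leq_bigmax_seq _ ps xpredT (fun p : {poly C} => size p) p pin isT).
by split; rewrite !leqW.
Qed.

Lemma chart_pole P x0 y0 : E1val P = Aff x0 y0 -> B.[x0] = 0 -> chart P.
Proof.
move=> PE b0; pose N : {poly C} := A * (A ^+ 2 - B ^+ 2).
have [n bound] := degree_bound [:: N; A * W; B * W].
have [_ sN] : (size N <= n.+2)%N /\ (size N <= n.+3)%N.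
  by apply: bound; rewrite !inE eqxx.
have [sAW _] : (size (A * W)%R <= n.+2)%N /\ (size (A * W)%R <= n.+3)%N.
  by apply: bound; rewrite !inE eqxx orbT.
have [sBW _] : (size (B * W)%R <= n.+2)%N /\ (size (B * W)%R <= n.+3)%N.
  by apply: bound; rewrite !inE eqxx !orbT.
exists n.+2, (c *: Y * homogenize (A * W) n.+1 X Z), (homogenize N n.+2 X Z),
  (c *: Y * homogenize (B * W) n.+1 X Z); split.
- by split; [exact: (dhomogM homcY (homXZ _ _))| |
    exact: (dhomogM homcY (homXZ _ _))].
- apply/or3P/Or32; rewrite PE evXZ_aff //.
  rewrite !hornerM hornerD hornerN !horner_exp b0 expr0n subr0.
  by rewrite mulf_neq0 ?expf_neq0 // num_neq0.
case=> [[|x y] on]; first by rewrite /represents !mevalM !evXZ_infty !mulr0 eqxx.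
have on' : y ^+ 2 = x ^+ 3 - x by apply/eqP.
rewrite !mevalM evcY (evXZ_aff _ _ sAW) (evXZ_aff _ _ sBW) (evXZ_aff _ _ sN).
rewrite /= !hornerM hornerD hornerN !horner_exp.
by have := represents_polar on'; congr (represents _ _ _ _); ring.
Qed.

Lemma chart_regular P x0 y0 : E1val P = Aff x0 y0 -> B.[x0] != 0 -> chart P.
Proof.
move=> PE b0; have [n bound] := degree_bound [:: A * B; W; B ^+ 2].
have [_ sAB] : (size (A * B)%R <= n.+2)%N /\ (size (A * B)%R <= n.+3)%N.
  by apply: bound; rewrite !inE eqxx.
have [sW _] : (size W <= n.+2)%N /\ (size W <= n.+3)%N.
  by apply: bound; rewrite !inE eqxx orbT.
have [_ sB2] : (size (B ^+ 2)%R <= n.+2)%N /\ (size (B ^+ 2)%R <= n.+3)%N.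
  by apply: bound; rewrite !inE eqxx !orbT.
exists n.+2, (homogenize (A * B) n.+2 X Z), (c *: Y * homogenize W n.+1 X Z),
  (homogenize (B ^+ 2) n.+2 X Z); split.
- by split=> //; exact: (dhomogM homcY (homXZ _ _)).
- by apply/or3P/Or33; rewrite PE evXZ_aff // horner_exp expf_neq0.
case=> [[|x y] on]; first by rewrite /represents !mevalM !evXZ_infty !mulr0 eqxx.
have on' : y ^+ 2 = x ^+ 3 - x by apply/eqP.
rewrite !mevalM evcY (evXZ_aff _ _ sAB) (evXZ_aff _ _ sW) (evXZ_aff _ _ sB2).
by rewrite /= hornerM horner_exp; exact: represents_regular on'.
Qed.

Lemma algebraic_phi : (size W < (size B).*2)%N -> algebraic_map phi.
Proof.
move=> size_W; apply: algebraic_of_charts => P.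
case PE: (E1val P) => [|x y]; first exact: chart_infty.
have [b0|b0] := eqVneq B.[x] 0; first exact: chart_pole PE b0.
exact: chart_regular PE b0.
Qed.

End RationalMap.

(** * The partial sums of the hypergeometric series *)

Section HypergeometricPolynomials.
Variable C : numClosedFieldType.
Implicit Types (p : {poly C}).

Lemma dvdp_deriv_Xn p n : 'X^(n.+1) %| p -> 'X^n %| p^`().
Proof.
move=> /dvdp_XnP h; apply/dvdp_XnP => i lt_in.
by rewrite coef_deriv h ?mul0rn.
Qed.

Lemma dvdp_Xn_deriv p n : p.[0] = 0 -> 'X^n %| p^`() -> 'X^(n.+1) %| p.
Proof.
move=> p0 /dvdp_XnP h; apply/dvdp_XnP => -[|i]; first by rewrite -horner_coef0.
rewrite ltnS => /h; rewrite coef_deriv => /eqP.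
by rewrite mulrn_eq0 => /eqP.
Qed.

(** The coefficients of (1 - z)^(-1/2). *)
Definition binom_coef k : C := pochhammer (1 / 2) k / k`!%:R.

Definition hyp_coef k : C :=
  pochhammer (1 / 2) k * pochhammer (1 / 4) k / (pochhammer (5 / 4) k * k`!%:R).

Lemma binom_coef0 : binom_coef 0 = 1.
Proof. by rewrite /binom_coef /pochhammer big_ord0 fact0 divr1. Qed.

Lemma binom_coefS k :
  2 * k.+1%:R * binom_coef k.+1 = (2 * k%:R + 1) * binom_coef k.
Proof.
rewrite /binom_coef /pochhammer big_ord_recr /= factS natrM.
have k1 : k.+1%:R != 0 :> C by rewrite pnatr_eq0.
have f0 : k`!%:R != 0 :> C by rewrite pnatr_eq0 -lt0n fact_gt0.
by field; rewrite f0 addrC natr1.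
Qed.

(** Since (1/4)_k / (5/4)_k = 1 / (4 k + 1). *)
Lemma hyp_coefE k : (4 * k%:R + 1) * hyp_coef k = binom_coef k.
Proof.
have f0 : k`!%:R != 0 :> C by rewrite pnatr_eq0 -lt0n fact_gt0.
have pos (a : C) j : 0 < a -> pochhammer a j != 0.
  move=> a0; apply/prodf_neq0 => i _; apply: lt0r_neq0.
  by rewrite ltr_wpDr.
have p0 : pochhammer (5 / 4) k != 0 :> C by apply: pos; rewrite divr_gt0 ?ltr0n.
have key : (4 * k%:R + 1) * pochhammer (1 / 4) k = pochhammer (5 / 4) k :> C.
  elim: k {f0 p0} => [|k ih]; first by rewrite /pochhammer !big_ord0; ring.
  rewrite {2}/pochhammer big_ord_recr -/(pochhammer _ _) -ih /=.
  by rewrite /pochhammer big_ord_recr /= -natr1; field.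
have p14 : pochhammer (1 / 4) k != 0 :> C by apply: pos; rewrite divr_gt0 ?ltr0n.
have k4 : 4 * k%:R + 1 != 0 :> C by rewrite -[4]/(4%:R) -natrM natr1 pnatr_eq0.
by rewrite /hyp_coef /binom_coef -key; field; rewrite f0 p14 k4.
Qed.

Lemma hyp_coef0 : hyp_coef 0 = 1.
Proof. by have := hyp_coefE 0; rewrite mulr0 add0r mul1r binom_coef0. Qed.

Definition hyp_poly n : {poly C} := \poly_(k < n.+1) hyp_coef k.

Definition binom_poly n : {poly C} := \poly_(k < n.+1) binom_coef k.

Lemma hyp_poly_ode n : 4 *: ('X * (hyp_poly n)^`()) + hyp_poly n = binom_poly n.
Proof.
apply/polyP => k; rewrite coefD coefZ coefXM coef_deriv !coef_poly.
case: k => [|k] /=; first by rewrite mulr0 add0r hyp_coef0 binom_coef0.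
case: ifP => _; last by rewrite mul0rn mulr0 addr0.
by rewrite -hyp_coefE -mulr_natr; ring.
Qed.

(** The truncation g of (1 - z)^(-1/2) satisfies 2 (1 - z) g' = g up to a multiple
of z^n, so the derivative of g^2 (1 - z) is a multiple of z^n. *)
Lemma binom_poly_sqr n : exists R : {poly C}, (size R <= n.+1)%N /\
  binom_poly n ^+ 2 * (1 - 'X) = 1 + 'X^(n.+1) * R.
Proof.
have ode : 2 *: ((binom_poly n)^`() * (1 - 'X)) - binom_poly n
    = - ((2 * n%:R + 1) * binom_coef n) *: 'X^n.
  have bE k : (binom_poly n)`_k = if (k <= n)%N then binom_coef k else 0.
    by rewrite coef_poly ltnS.
  have bS k : k.+1%:R * binom_coef k.+1 = (2 * k%:R + 1) / 2 * binom_coef k.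
    by rewrite mulrAC -binom_coefS; field.
  have dE k : (binom_poly n)^`()`_k =
      if (k < n)%N then (2 * k%:R + 1) / 2 * binom_coef k else 0.
    rewrite coef_deriv bE; case: ifP => _; last by rewrite mul0rn.
    by rewrite -[_ *+ k.+1]mulr_natl bS.
  apply/polyP => k; rewrite coefB coefZ mulrBr mulr1 coefB coefMX coefZ coefXn.
  have xE : (if (k == 0)%N then 0 else (binom_poly n)^`()`_k.-1) =
      if (k <= n)%N then k%:R * binom_coef k else 0.
    case: k => [|k] /=; first by rewrite mul0r.
    rewrite dE; by case: ifP => // _; rewrite bS.
  rewrite xE dE bE; case: ltngtP => [_|_|->] /=; [by field|by ring|].
  by ring.
have dvd : 'X^(n.+1) %| binom_poly n ^+ 2 * (1 - 'X) - 1.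
  apply: dvdp_Xn_deriv.
    rewrite hornerD hornerM hornerD !hornerN hornerX horner_exp !hornerC.
    by rewrite horner_coef0 coef_poly binom_coef0 expr1n subr0 mulr1 subrr.
  have -> : (binom_poly n ^+ 2 * (1 - 'X) - 1)^`() = binom_poly n *
      (2 *: ((binom_poly n)^`() * (1 - 'X)) - binom_poly n).
    rewrite !poly.derivE -!mul_polyC.
    by ring.
  by rewrite ode; apply: dvdp_mull; rewrite -mul_polyC; exact: dvdp_mull.
have /dvdpP[R RE] := dvd; exists R; split; last by rewrite ['X^_ * R]mulrC -RE; ring.
have [->|R0] := eqVneq R 0; first by rewrite size_poly0.
rewrite -(leq_add2l n.+1) -(size_mulXn _ R0). rewrite -RE.
have sb : (size (binom_poly n) <= n.+1)%N by exact: size_poly.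
have s1 : (size (1 - 'X : {poly C})%R <= 2)%N.
  by rewrite -opprB size_polyN size_XsubC.
apply: leq_trans (size_polyD _ _) _; rewrite geq_max size_polyN size_poly1 andbT.
apply: leq_trans (size_polyMleq _ _) _; rewrite expr2.
have s2 := size_polyMleq (binom_poly n) (binom_poly n).
have arith (a b d : nat) : (a <= n.+1)%N -> (b <= (a + a).-1)%N -> (d <= 2)%N ->
  ((b + d).-1 <= n.+1 + n.+1)%N by lia.
exact: arith sb s2 s1.
Qed.

Lemma homogenize_binom_sqr n (U V : {poly C}) : V != 0 -> exists R,
  homogenize (binom_poly n) n U V ^+ 2 * (V - U) = V ^+ (2 * n + 1) + U ^+ n.+1 * R.
Proof.
move=> V0; have [R [sR RE]] := binom_poly_sqr n; exists (homogenize R n U V).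
apply/eqP; rewrite -subr_eq0; apply/eqP; apply: (poly_eq0_generic V0) => z Vz.
have hw : U.[z] = U.[z] / V.[z] * V.[z] by rewrite divfK.
set w := _ / _ in hw.
have e : (binom_poly n).[w] ^+ 2 * (1 - w) = 1 + w ^+ n.+1 * R.[w].
  have /(congr1 (horner^~ w)) := RE.
  by rewrite !(horner_exp, hornerD, hornerN, hornerM, hornerX, hornerXn, hornerC).
rewrite !(horner_exp, hornerD, hornerN, hornerM).
rewrite (horner_homogenize (size_poly _ _) hw) (horner_homogenize sR hw) hw.
transitivity (V.[z] ^+ (2 * n + 1) * ((binom_poly n).[w] ^+ 2 * (1 - w) - (1 + w ^+ n.+1 * R.[w]))).
  rewrite exprD mul2n -addnn exprD expr1 !exprMn !exprS; ring.
by rewrite e subrr mulr0.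
Qed.

Lemma poly_eq0_of_dvdp_Xn (p : {poly C}) : (forall n, 'X^(n.+1) %| p) -> p = 0.
Proof.
move=> h; apply/polyP => i; rewrite coef0.
by have /dvdp_XnP := h i; apply.
Qed.

End HypergeometricPolynomials.

(** * From the hypergeometric identity to an algebraic identity *)

Section FormalIdentity.
Variables (C : numClosedFieldType) (N D : {poly C}) (mu0 : C).
Hypothesis mu0_neq0 : mu0 != 0.
Hypothesis N0 : N.[0] != 0.

(** The rational function mu(1 / z) is N / D, so that U / V is z / mu(1 / z)^2,
and Q is N D times the factor z (U / V)' / (U / V). *)
Let U : {poly C} := 'X * D ^+ 2.
Let V : {poly C} := N ^+ 2.
Let Q : {poly C} := N * D + 2 *: ('X * (D^`() * N - D * N^`())).

(** Up to a power of N, the difference of the two sides of the squared identity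
F(z)^2 N = mu0 D F(U / V)^2, with F replaced by its n-th partial sum. *)
Definition defect n : {poly C} :=
  hyp_poly C n ^+ 2 * N ^+ (4 * n + 1) - mu0 *: (D * homogenize (hyp_poly C n) n U V ^+ 2).

Lemma deriv_homogenize (p : {poly C}) n :
  'X * D * N * (homogenize p n U V)^`() =
    homogenize ('X * p^`()) n U V * Q
    + (2 * n%:R) *: ('X * D * N^`() * homogenize p n U V).
Proof.
have expd (k : nat) (q r s t : {poly C}) : r * q^`() = s * q * t ->
    r * (q ^+ k)^`() = k%:R *: (s * q ^+ k * t).
  move=> e; case: k => [|k]; first by rewrite expr0 derivC mulr0 scale0r.
  rewrite deriv_exp /= mulrnAr mulrA e -scaler_nat exprS; congr (_ *: _); ring.
have eU : 'X * D * U^`() = 1 * U * (D + 2 *: ('X * D^`())).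
  by rewrite /U !poly.derivE -!mul_polyC; ring.
have eV : N * V^`() = 1 * V * (2 *: N^`()).
  by rewrite /V !poly.derivE -!mul_polyC; ring.
rewrite /homogenize raddf_sum !mulr_sumr mulr_suml scaler_sumr -big_split /=.
apply: eq_bigr => k _; have kn : (k <= n)%N by rewrite -ltnS.
have -> : ('X * p^`())`_k = k%:R * p`_k.
  rewrite coefXM; case: (nat_of_ord k) => [|j] /=; first by rewrite mul0r.
  by rewrite coef_deriv mulr_natl.
have nE : n%:R = k%:R + (n - k)%:R :> C by rewrite -natrD subnKC.
have eUk := expd k _ _ _ _ eU; have eVk := expd (n - k)%N _ _ _ _ eV.
rewrite derivZ derivM nE.
transitivity (p`_k *: (('X * D * (U ^+ k)^`()) * N * V ^+ (n - k)
   + 'X * D * U ^+ k * (N * (V ^+ (n - k))^`()))).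
  by rewrite -!mul_polyC; ring.
by rewrite eUk eVk /Q -!mul_polyC !(polyCM, polyCD); ring.
Qed.

(** The combination 2 N z P' - (2 (4 n + 1) z N' - N) P of P = [defect n] and its
derivative is chosen so that the derivatives of the partial sum f only occur in
4 z f' + f. *)
Lemma defect_step n : 'X^(n.+1) %| defect n ->
  'X^(n.+1) %| hyp_poly C n * binom_poly C n * N ^+ (4 * n + 2)
    - mu0 *: (homogenize (hyp_poly C n) n U V * homogenize (binom_poly C n) n U V * Q).
Proof.
move=> dvd.
set f := hyp_poly C n; set g := binom_poly C n.
set H := homogenize f n U V; set G := homogenize g n U V; set H1 := homogenize ('X * f^`()) n U V.
have gE : g = 4 *: ('X * f^`()) + f by rewrite /g -hyp_poly_ode.
have GE : G = 4 *: H1 + H.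
  rewrite /G /g -hyp_poly_ode /H1 /H /homogenize scaler_sumr -big_split /=.
  by apply: eq_bigr => k _; rewrite coefD coefZ scalerDl scalerA.
have H'E : 'X * D * N * H^`() = H1 * Q + (2 * n%:R) *: ('X * D * N^`() * H).
  exact: deriv_homogenize.
have dvd' : 'X^(n.+1) %| 'X * (defect n)^`().
  rewrite exprS; apply: dvdp_mul => //; exact: dvdp_deriv_Xn.
have -> : f * g * N ^+ (4 * n + 2) - mu0 *: (H * G * Q) =
    2 *: (N * ('X * (defect n)^`()))
    - (2 * (4 * n%:R + 1)) *: ('X * N^`() * defect n) + N * defect n.
  have eN1 : N ^+ (4 * n + 1) = N ^+ (4 * n) * N by rewrite exprD expr1.
  have eN2 : N ^+ (4 * n + 2) = N ^+ (4 * n) * N ^+ 2 by rewrite exprD.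
  have dN : (N ^+ (4 * n + 1))^`() = (4 * n%:R + 1) *: (N^`() * N ^+ (4 * n)).
    by rewrite addn1 deriv_exp /= -scaler_nat -natr1 natrM.
  rewrite /defect -/f -/H derivB derivZ !derivM dN eN1 eN2.
  move: (N ^+ (4 * n)) => E.
  transitivity (4 *: (f * ('X * f^`()) * N ^+ 2 * E) + f ^+ 2 * N ^+ 2 * E
    - mu0 *: (2 *: (N * 'X * D^`() * H ^+ 2) + 4 *: (H * ('X * D * N * H^`())))
    + mu0 *: ((2 * (4 * n%:R + 1)) *: ('X * N^`() * D * H ^+ 2) - N * D * H ^+ 2)).
    rewrite H'E GE gE; clearbody H1 H; clearbody f; rewrite /Q.
    move: ('X * f^`()) => F1.
    by rewrite -!mul_polyC !(polyCM, polyCD); ring.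
  by rewrite -!mul_polyC !(polyCM, polyCD); ring.
apply: dvdp_add; [apply: dvdp_sub|exact: dvdp_mull].
  by rewrite -mul_polyC; do 2! apply: dvdp_mull.
by rewrite -mul_polyC; do 2! apply: dvdp_mull.
Qed.

(** The congruences [defect n] = 0 and [defect_step], after squaring the latter,
have a common factor that is cancelled; this eliminates F, and the squares of the
truncations of (1 - z)^(-1/2) are replaced by 1 / (1 - z) and V / (V - U). *)
Theorem formal_identity : (forall n, 'X^(n.+1) %| defect n) ->
  D * N * (N ^+ 2 - 'X * D ^+ 2) = mu0 *: ((1 - 'X) * Q ^+ 2).
Proof.
move=> dvd; apply/eqP; rewrite -subr_eq0; apply/eqP.
apply: poly_eq0_of_dvdp_Xn => n.
have step := defect_step (dvd n); have dvdn := dvd n.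
rewrite /defect in dvdn; set f := hyp_poly C n in step dvdn.
set g := binom_poly C n in step; set H := homogenize f n U V in step dvdn.
set G := homogenize g n U V in step.
have V0 : V != 0.
  by rewrite /V expf_neq0 //; apply: contraNneq N0 => ->; rewrite horner0.
have [R1 R1E] := binom_poly_sqr C n; move: R1E => [_ R1E]; rewrite -/g in R1E.
have [R2 R2E] := homogenize_binom_sqr n U V0; rewrite -/g -/G in R2E.
have UX : 'X^(n.+1) %| U ^+ n.+1 by apply: dvdp_exp2r; rewrite /U dvdp_mulr.
have H0 : H.[0] != 0.
  have hw : U.[0] = 0 * V.[0] by rewrite /U hornerM hornerX !mul0r.
  rewrite /H (horner_homogenize (size_poly _ _) hw) [f.[0]]horner_coef0.
  rewrite /f /hyp_poly coef_poly hyp_coef0 mulr1.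
  by rewrite /V horner_exp !expf_neq0.
have cop (p : {poly C}) k q : p.[0] != 0 -> 'X^(n.+1) %| p ^+ k * q -> 'X^(n.+1) %| q.
  by move=> p0; rewrite Gauss_dvdpr // coprimep_Xn // horner_exp expf_neq0.
have s1 : 'X^(n.+1) %| D * g ^+ 2 * N ^+ (4 * n + 3) - mu0 *: (G ^+ 2 * Q ^+ 2).
  apply: (cop H 2 _ H0); rewrite -(@dvdpZr _ mu0) //.
  rewrite (_ : _ *: _ = (f * g * N ^+ (4 * n + 2) - mu0 *: (H * G * Q)) *
      (f * g * N ^+ (4 * n + 2) + mu0 *: (H * G * Q))
    - g ^+ 2 * N ^+ (4 * n + 3) * (f ^+ 2 * N ^+ (4 * n + 1) - mu0 *: (D * H ^+ 2))).
    by apply: dvdp_sub; [exact: dvdp_mulr|exact: dvdp_mull].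
  rewrite !exprD; clearbody f g H G; move: (N ^+ (4 * n)) => E.
  by rewrite -!mul_polyC; ring.
apply: (cop N (4 * n + 2)%N _ N0).
rewrite (_ : _ * _ = (D * g ^+ 2 * N ^+ (4 * n + 3) - mu0 *: (G ^+ 2 * Q ^+ 2))
     * ((1 - 'X) * (V - U))
   - (D * N ^+ (4 * n + 3) * (V - U) * R1) * 'X^(n.+1)
   + (mu0 *: (Q ^+ 2 * (1 - 'X) * R2)) * U ^+ n.+1).
  apply: dvdp_add; [apply: dvdp_sub|]; [exact: dvdp_mulr|exact: dvdp_mull|exact: dvdp_mull].
have VN : V ^+ (2 * n + 1) = N ^+ (4 * n + 2).
  by rewrite /V -exprM; congr (_ ^+ _); lia.
transitivity (D * N ^+ (4 * n + 3) * (V - U) * (1 + 'X^(n.+1) * R1)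
   - mu0 *: ((V ^+ (2 * n + 1) + U ^+ n.+1 * R2) * (1 - 'X) * Q ^+ 2)
   - (D * N ^+ (4 * n + 3) * (V - U) * R1) * 'X^(n.+1)
   + (mu0 *: (Q ^+ 2 * (1 - 'X) * R2)) * U ^+ n.+1); last first.
  rewrite -R1E -R2E; clearbody g G; clear; move: (U ^+ n.+1) 'X^(n.+1) => u x.
  by rewrite -!mul_polyC; ring.
rewrite VN; move: (U ^+ n.+1) 'X^(n.+1) => u x.
have -> : N ^+ (4 * n + 3) = N ^+ (4 * n + 2) * N by rewrite -exprSr addnS.
rewrite /V /U; move: (N ^+ (4 * n + 2)) => E.
by rewrite -!mul_polyC; ring.
Qed.

End FormalIdentity.

Section PuncturedNeighbourhood.
Variable C : numClosedFieldType.

Lemma cvg_punctured_id : z @[z --> (0 : C)^'] --> (0 : C).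
Proof. exact: cvg_within. Qed.

Lemma dvdp_Xn_of_cvg (p : {poly C}) n :
  p.[z] / z ^+ n @[z --> (0 : C)^'] --> (0 : C) -> 'X^(n.+1) %| p.
Proof.
have FF : ProperFilter (0 : C)^' by exact: _.
have base (q : {poly C}) : q.[z] @[z --> (0 : C)^'] --> (0 : C) -> q.[0] = 0.
  move=> h; have h2 := cvg_horner (FF := FF) (p := q) cvg_punctured_id.
  exact: (@norm_cvg_unique C C^o (q.[z] @[z --> (0 : C)^'])).
have nz : \forall z \near (0 : C)^', z != 0 by exact: nbhs_dnbhs_neq.
elim: n p => [|n ih] p h.
  rewrite expr1 -(subr0 'X) dvdp_XsubCl; apply/rootP/base.
  by under eq_fun do rewrite -[_.[_]]divr1; exact: h.
have /dvdpP[q qE] : 'X^(n.+1) %| p.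
  apply: ih; have := cvgM (FF := FF) h cvg_punctured_id; rewrite mul0r.
  apply: cvg_trans; apply: near_eq_cvg; apply: filterS nz => z z0 /=.
  by rewrite exprSr invfM mulrA divfK.
rewrite qE (exprS 'X n.+1); apply: dvdp_mul => //.
rewrite -(subr0 'X) dvdp_XsubCl; apply/rootP/base.
apply: cvg_trans h; apply: near_eq_cvg; apply: filterS nz => z z0 /=.
by rewrite qE hornerM hornerXn mulfK // expf_neq0.
Qed.

End PuncturedNeighbourhood.

Section AnalyticIdentity.
Variables (C : numClosedFieldType) (N D : {poly C}) (mu0 : C) (F : C -> C).
Hypothesis F_tail : forall z n, `|z| <= 1 / 2 ->
  `|F z - (hyp_poly C n).[z]| <= 2 * `|z| ^+ n.+1.
Hypothesis N0 : N.[0] != 0.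
Hypothesis D0 : D.[0] != 0.
Hypothesis identity : \forall z \near (0 : C)^',
  F z ^+ 2 * N.[z] = mu0 * D.[z] * F (z * D.[z] ^+ 2 / N.[z] ^+ 2) ^+ 2.

(** As z D^2 / N^2 = O(z), replacing F by its n-th partial sum changes both sides
of the identity by o(z^n). *)
Lemma dvdp_defect n : 'X^(n.+1) %| defect N D mu0 n.
Proof.
apply: dvdp_Xn_of_cvg.
have FF : ProperFilter (0 : C)^' by exact: _.
have zl := @cvg_punctured_id C.
have Nl := cvg_horner (FF := FF) (p := N) zl.
have Dl := cvg_horner (FF := FF) (p := D) zl.
pose f := hyp_poly C n.
pose r z := D.[z] ^+ 2 / N.[z] ^+ 2; pose w z := z * r z.
have rl : r z @[z --> (0 : C)^'] --> r 0.
  apply: cvgM; first exact: (cvgM Dl Dl).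
  by apply: cvgV; [rewrite expf_neq0|exact: (cvgM Nl Nl)].
have wl : w z @[z --> (0 : C)^'] --> (0 : C).
  by have := cvgM (FF := FF) zl rl; rewrite mul0r.
have expl (g : C -> C) (l : C) k : g z @[z --> (0 : C)^'] --> l ->
    g z ^+ k @[z --> (0 : C)^'] --> l ^+ k.
  move=> gl; have := cvg_horner (FF := FF) (p := 'X^k) gl; rewrite hornerXn.
  by under eq_fun do rewrite hornerXn.
have nz : \forall z \near (0 : C)^', z != 0 by exact: nbhs_dnbhs_neq.
have small (g : C -> C) : g z @[z --> (0 : C)^'] --> (0 : C) ->
    \forall z \near (0 : C)^', `|g z| <= 1 / 2.
  move=> /cvgr0Pnorm_lt gl; have h : 0 < 1 / 2 :> C by rewrite divr_gt0 ?ltr0n.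
  by apply: filterS (gl _ h) => z /ltW.
have c2 : (fun=> 2) z @[z --> (0 : C)^'] --> (2 : C) by exact: cvg_cst.
pose a z := F z - f.[z].
have al : a z / z ^+ n @[z --> (0 : C)^'] --> (0 : C).
  apply: (cvg_dominated0 (g := fun z => 2 * z)).
    apply: filterS2 nz (small id zl) => z z0 zs /=.
    rewrite normrM normfV ler_pdivrMr ?normr_gt0 ?expf_neq0 //.
    apply: le_trans (F_tail n zs) _.
    by rewrite normrM normrX exprS mulrA ger0_norm ?ler0n.
  by have := cvgM (FF := FF) c2 zl; rewrite mulr0.
have bl : a (w z) / z ^+ n @[z --> (0 : C)^'] --> (0 : C).
  apply: (cvg_dominated0 (g := fun z => 2 * (r z ^+ n.+1 * z))).
    apply: filterS2 nz (small w wl) => z z0 zs /=.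
    rewrite normrM normfV ler_pdivrMr ?normr_gt0 ?expf_neq0 //.
    apply: le_trans (F_tail n zs) _.
    rewrite (normrM z (r z)) (normrM 2) (normrM (r z ^+ n.+1) z) !normrX.
    rewrite exprMn [`|z| ^+ n.+1]exprS (@ger0_norm _ 2) ?ler0n //.
    move: (`|r z| ^+ n.+1) (`|z| ^+ n) => x y.
    by rewrite le_eqVlt; apply/orP; left; apply/eqP; ring.
  have := cvgM (FF := FF) c2 (cvgM (FF := FF) (expl _ _ n.+1 rl) zl).
  by rewrite !mulr0.
have unscale (g : C -> C) : g z / z ^+ n @[z --> (0 : C)^'] --> (0 : C) ->
    g z @[z --> (0 : C)^'] --> (0 : C).
  move=> gl; have := cvgM (FF := FF) gl (expl _ _ n zl); rewrite mul0r.
  apply: cvg_trans; apply: near_eq_cvg; apply: filterS nz => z z0 /=.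
  by rewrite divfK // expf_neq0.
have fl := cvg_horner (FF := FF) (p := f) zl.
have fwl := cvg_horner (FF := FF) (p := f) wl.
have lim : N.[z] ^+ (4 * n) * (mu0 * D.[z] * (a (w z) / z ^+ n * (2 * f.[w z] + a (w z)))
      - a z / z ^+ n * (2 * f.[z] + a z) * N.[z]) @[z --> (0 : C)^'] -->
    N.[0] ^+ (4 * n) * (mu0 * D.[0] * (0 * (2 * f.[0] + 0)) - 0 * (2 * f.[0] + 0) * N.[0]).
  apply: cvgM; first exact: expl.
  apply: cvgB; apply: cvgM => //.
  - by apply: cvgM => //; exact: cvg_cst.
  - apply: cvgM => //; apply: cvgD; last exact: (unscale (a \o w)).
    by apply: cvgM => //; exact: cvg_cst.
  - apply: cvgM => //; apply: cvgD; last exact: unscale.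
    by apply: cvgM => //; exact: cvg_cst.
rewrite !(mul0r, mulr0, subr0) in lim.
apply: cvg_trans lim; apply: near_eq_cvg.
near=> z.
have z0 : z != 0 by near: z.
have Nz : N.[z] != 0 by near: z; exact: cvgr_neq0 Nl N0.
have id_z : F z ^+ 2 * N.[z] = mu0 * D.[z] * F (w z) ^+ 2.
  rewrite /w /r mulrA; near: z; exact: identity.
have wE : ('X * D ^+ 2).[z] = w z * (N ^+ 2).[z].
  by rewrite /w /r !(horner_exp, hornerM, hornerX); field.
rewrite /defect -/f !(hornerD, hornerN, hornerZ, hornerM, horner_exp).
rewrite (horner_homogenize (size_poly _ _) wE) horner_exp.
have zn : z ^+ n != 0 by rewrite expf_neq0.
have FE : F z = a z + f.[z] by rewrite /a subrK.
have FwE : F (w z) = a (w z) + f.[w z] by rewrite /a subrK.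
rewrite FE FwE in id_z.
have -> : N.[z] ^+ 2 ^+ n = N.[z] ^+ (2 * n) by rewrite exprM.
have e1 : N.[z] ^+ (4 * n + 1) = N.[z] ^+ (2 * n) ^+ 2 * N.[z].
  by rewrite -exprM exprD expr1; congr (_ ^+ _ * _); lia.
have e2 : N.[z] ^+ (4 * n) = N.[z] ^+ (2 * n) ^+ 2 by rewrite -exprM; congr (_ ^+ _); lia.
rewrite e1 e2; move: (N.[z] ^+ (2 * n)) => E.
transitivity (E ^+ 2 * ((f.[z] ^+ 2 * N.[z] - mu0 * D.[z] * f.[w z] ^+ 2)
  - ((a z + f.[z]) ^+ 2 * N.[z] - mu0 * D.[z] * (a (w z) + f.[w z]) ^+ 2)) / z ^+ n).
  by field.
by rewrite id_z subrr subr0; congr (_ / _); ring.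
Unshelve. all: by end_near.
Qed.

End AnalyticIdentity.

Section Reversal.
Variable C : numClosedFieldType.
Implicit Types p : {poly C}.

Lemma revp_deriv p n : 'X * (revp p n)^`() = n%:R *: revp p n - revp ('X * p^`()) n.
Proof.
apply/polyP => k; rewrite coefB coefZ coefXM coef_deriv !coef_poly.
have e : ('X * p^`())`_(n - k) = (n - k)%:R * p`_(n - k).
  rewrite coefXM; case: (n - k)%N => [|j] /=; first by rewrite mul0r.
  by rewrite coef_deriv mulr_natl.
rewrite e; case: k {e} => [|k] /=.
  by rewrite subn0 subrr.
case: ifP => [kn|_]; last by rewrite mul0rn mulr0 subr0.
by rewrite natrB // -mulr_natr; ring.
Qed.

Lemma revp_deriv_horner p n z : (size p <= n.+1)%N -> z != 0 ->
  z * (revp p n)^`().[z] = z ^+ n * (n%:R * p.[z^-1] - z^-1 * p^`().[z^-1]).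
Proof.
move=> sp z0; have /(congr1 (horner^~ z)) := revp_deriv p n.
rewrite !(hornerM, hornerX, hornerD, hornerN, hornerZ) => ->.
rewrite !revp_horner //; first by rewrite hornerM hornerX; ring.
have [->|p0] := eqVneq p^`() 0; first by rewrite mulr0 size_poly0.
rewrite mulrC size_mulX //; apply: leq_trans sp; apply: lt_size_deriv.
by apply: contraNneq p0 => ->; rewrite derivC.
Qed.

(** The identity of [formal_identity] in terms of the variable s = 1 / z. *)
Lemma reversed_identity (n d : {poly C}) (m : nat) (mu0 : C) :
  (size n <= m.+1)%N -> (size d <= m.+1)%N ->
  let N := revp n m in let D := revp d m in
  D * N * (N ^+ 2 - 'X * D ^+ 2) = mu0 *: ((1 - 'X) *
    (N * D + 2 *: ('X * (D^`() * N - D * N^`()))) ^+ 2) ->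
  forall s, n.[s] * d.[s] * (s * n.[s] ^+ 2 - d.[s] ^+ 2) = mu0 * (s - 1) *
    (n.[s] * d.[s] + 2 * s * (n^`().[s] * d.[s] - n.[s] * d^`().[s])) ^+ 2.
Proof.
move=> sn sd N D e.
pose L : {poly C} := n * d * ('X * n ^+ 2 - d ^+ 2).
pose M : {poly C} := mu0 *: (('X - 1%:P) * (n * d + 2 *: ('X * (n^`() * d - n * d^`()))) ^+ 2).
suff LM : L - M = 0.
  move=> s; have /(congr1 (horner^~ s)) := LM.
  rewrite /L /M !(horner_exp, hornerM, hornerX, hornerD, hornerN, hornerZ, hornerC) => /eqP.
  by rewrite subr_eq0 => /eqP ->; ring.
apply: (poly_eq0_generic (negbT (polyX_eq0 C))) => s; rewrite hornerX => s0.
have z0 : s^-1 != 0 by rewrite invr_eq0.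
have /(congr1 (horner^~ s^-1)) := e.
have -> : (D * N * (N ^+ 2 - 'X * D ^+ 2)).[s^-1]
    = s^-1 ^+ m ^+ 4 * (n.[s] * d.[s] * (n.[s] ^+ 2 - s^-1 * d.[s] ^+ 2)).
  rewrite !(horner_exp, hornerM, hornerX, hornerD, hornerN).
  by rewrite !revp_horner // !invrK; ring.
have -> : (mu0 *: ((1 - 'X) *
    (N * D + 2 *: ('X * (D^`() * N - D * N^`()))) ^+ 2)).[s^-1] =
   s^-1 ^+ m ^+ 4 * (mu0 * (1 - s^-1) *
    (n.[s] * d.[s] + 2 * s * (n^`().[s] * d.[s] - n.[s] * d^`().[s])) ^+ 2).
  rewrite !(horner_exp, hornerM, hornerX, hornerD, hornerN, hornerZ, hornerC).
  have e1 := revp_deriv_horner sn z0; have e2 := revp_deriv_horner sd z0.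
  rewrite !invrK -/N -/D in e1 e2.
  have -> : s^-1 * (D^`().[s^-1] * N.[s^-1] - D.[s^-1] * N^`().[s^-1]) =
     s^-1 * D^`().[s^-1] * N.[s^-1] - D.[s^-1] * (s^-1 * N^`().[s^-1]) by ring.
  by rewrite e1 e2 !revp_horner // !invrK; ring.
move=> /(mulfI (expf_neq0 4 (expf_neq0 m z0))) h.
rewrite /L /M !(horner_exp, hornerM, hornerX, hornerD, hornerN, hornerZ, hornerC).
transitivity (s * (n.[s] * d.[s] * (n.[s] ^+ 2 - s^-1 * d.[s] ^+ 2) -
   mu0 * (1 - s^-1) *
    (n.[s] * d.[s] + 2 * s * (n^`().[s] * d.[s] - n.[s] * d^`().[s])) ^+ 2)).
  by field.
by rewrite h subrr mulr0.
Qed.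

End Reversal.

Section LimitAtInfinity.
Variables (C : numClosedFieldType) (n d : {poly C}) (mu0 : C).
Hypothesis mu0_neq0 : mu0 != 0.
Hypothesis d_neq0 : d != 0.
Hypothesis lim : n.[s] / d.[s] @[s --> cinfty] --> mu0.

Lemma size_of_limit : exists m, [/\ size n = m.+1, size d = m.+1 & n`_m = mu0 * d`_m].
Proof.
pose m := (maxn (size n) (size d)).-1.
have d1 : (0 < size d)%N by rewrite size_poly_gt0.
have sn : (size n <= m.+1)%N by rewrite /m; move: d1; set a := size n; set b := size d; lia.
have sd : (size d <= m.+1)%N by rewrite /m; move: d1; set a := size n; set b := size d; lia.
have FF : ProperFilter (@cinfty C) by exact: _.
have nl := cvg_horner (FF := FF) (p := revp n m) (@cvg_cinftyV C).
have dl := cvg_horner (FF := FF) (p := revp d m) (@cvg_cinftyV C).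
rewrite !revp0 in nl dl.
have e : n`_m = mu0 * d`_m.
  apply/eqP; rewrite -subr_eq0; apply/eqP.
  have h : (revp n m).[s^-1] - n.[s] / d.[s] * (revp d m).[s^-1] @[s --> cinfty]
      --> n`_m - mu0 * d`_m.
    by apply: cvgB => //; apply: cvgM.
  apply: (cvg_near0_eq h).
  apply: filterS2 (near_cinfty_horner_neq0 d_neq0) (@cinfty_neq0 C) => s ds s0.
  by rewrite !revp_horner ?invr_eq0 // !invrK; field.
have full (p : {poly C}) : (size p <= m.+1)%N -> p`_m != 0 -> size p = m.+1.
  move=> sp pm; apply/eqP; rewrite eqn_leq sp /= ltnNge; apply: contraNN pm => h.
  by rewrite nth_default.
have dm : d`_m != 0.
  apply/eqP => dm0; have nm0 : n`_m = 0 by rewrite e dm0 mulr0.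
  have [le|lt] := leqP (size n) (size d).
    have mE : m = (size d).-1 by rewrite /m (maxn_idPr le).
    by move: dm0; rewrite mE -lead_coefE; apply/eqP; rewrite lead_coef_eq0.
  have mE : m = (size n).-1 by rewrite /m (maxn_idPl (ltnW lt)).
  move: nm0; rewrite mE -lead_coefE; apply/eqP; rewrite lead_coef_eq0.
  by rewrite -size_poly_gt0 (leq_ltn_trans _ lt).
exists m; split=> //; apply: full => //.
by rewrite e mulf_neq0.
Qed.

Variable F : C -> C.
Hypothesis F_tail : forall z n, `|z| <= 1 / 2 ->
  `|F z - (hyp_poly C n).[z]| <= 2 * `|z| ^+ n.+1.
Hypothesis identity : \forall z \near (0 : C)^',
  n.[z^-1] / d.[z^-1] != 0 -> F z ^+ 2 * (n.[z^-1] / d.[z^-1]) =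
    mu0 * F (z / (n.[z^-1] / d.[z^-1]) ^+ 2) ^+ 2.

Lemma algebraic_identity : exists m, [/\ size n = m.+1, size d = m.+1 &
  forall s, n.[s] * d.[s] * (s * n.[s] ^+ 2 - d.[s] ^+ 2) = mu0 * (s - 1) *
    (n.[s] * d.[s] + 2 * s * (n^`().[s] * d.[s] - n.[s] * d^`().[s])) ^+ 2].
Proof.
have [m [sn sd lead]] := size_of_limit; exists m; split=> //.
have dm : d`_m != 0.
  by have := d_neq0; rewrite -lead_coef_eq0 lead_coefE sd.
pose N := revp n m; pose D := revp d m.
have N0 : N.[0] != 0 by rewrite revp0 lead mulf_neq0.
have D0 : D.[0] != 0 by rewrite revp0.
apply: (reversed_identity (eq_leq sn) (eq_leq sd)).
apply: (formal_identity mu0_neq0 N0); apply: (dvdp_defect F_tail N0 D0).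
have FF : ProperFilter (0 : C)^' by exact: _.
have near_neq0 (p : {poly C}) : p.[0] != 0 -> \forall z \near (0 : C)^', p.[z] != 0.
  move=> p0; have h := cvg_horner (FF := FF) (p := p) (@cvg_punctured_id C).
  exact: cvgr_neq0 h p0.
have nz : \forall z \near (0 : C)^', z != 0 by exact: nbhs_dnbhs_neq.
near=> z.
have z0 : z != 0 by near: z.
have Nz : N.[z] != 0 by near: z; exact: near_neq0.
have Dz : D.[z] != 0 by near: z; exact: near_neq0.
have rE : n.[z^-1] / d.[z^-1] = N.[z] / D.[z].
  have zm : z ^+ m != 0 by rewrite expf_neq0.
  have NE : N.[z] = z ^+ m * n.[z^-1] by rewrite revp_horner ?sn.
  have DE : D.[z] = z ^+ m * d.[z^-1] by rewrite revp_horner ?sd.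
  have dz : d.[z^-1] != 0 by move: Dz; rewrite DE mulf_eq0 negb_or => /andP[].
  by rewrite NE DE; field; rewrite dz zm.
have id_z : F z ^+ 2 * (N.[z] / D.[z]) = mu0 * F (z / (N.[z] / D.[z]) ^+ 2) ^+ 2.
  have : N.[z] / D.[z] != 0 by rewrite mulf_neq0 ?invr_eq0.
  rewrite -rE; near: z; exact: identity.
have -> : z * D.[z] ^+ 2 / N.[z] ^+ 2 = z / (N.[z] / D.[z]) ^+ 2 by field; rewrite Nz Dz.
transitivity (F z ^+ 2 * (N.[z] / D.[z]) * D.[z]); first by field.
by rewrite id_z; ring.
Unshelve. all: by end_near.
Qed.

End LimitAtInfinity.

(** * The isogeny *)

Section Isogeny.
Variables (C : numClosedFieldType) (n d : {poly C}) (mu0 : C) (m : nat).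
Hypothesis size_n : size n = m.+1.
Hypothesis size_d : size d = m.+1.
Hypothesis rel : forall s, n.[s] * d.[s] * (s * n.[s] ^+ 2 - d.[s] ^+ 2) =
  mu0 * (s - 1) *
    (n.[s] * d.[s] + 2 * s * (n^`().[s] * d.[s] - n.[s] * d^`().[s])) ^+ 2.

Lemma size_comp_X2 (p : {poly C}) : size p = m.+1 -> size (p \Po 'X^2) = (2 * m).+1.
Proof.
move=> sp; rewrite polySpred ?size_comp_poly ?sp ?size_polyXn 1?mulnC //.
by rewrite comp_poly_eq0 ?size_polyXn // -size_poly_gt0 sp.
Qed.

(** The function x n(x^2) / d(x^2) may have to be reduced although n and d are
coprime: d may vanish at 0. *)
Lemma lowest_terms : exists A B g : {poly C},
  [/\ 'X * (n \Po 'X^2) = A * g, d \Po 'X^2 = B * g, B != 0, coprimep A B &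
  [/\ size A = (size B).+1,
      (size (A^`() * B - A * B^`())%R < (size B).*2)%N &
      forall x, mu0 * (x ^+ 3 - x) * (A^`() * B - A * B^`()).[x] ^+ 2
        = A.[x] * B.[x] * (A.[x] ^+ 2 - B.[x] ^+ 2)]].
Proof.
pose A0 := 'X * (n \Po 'X^2); pose B0 := d \Po 'X^2; pose g := gcdp A0 B0.
have sB0 : size B0 = (2 * m).+1 by exact: size_comp_X2.
have sn2 : size (n \Po 'X^2) = (2 * m).+1 by exact: size_comp_X2.
have sA0 : size A0 = (2 * m).+2.
  by rewrite /A0 mulrC size_mulX ?sn2 // -size_poly_gt0 sn2.
have A00 : A0 != 0 by rewrite -size_poly_gt0 sA0.
have B00 : B0 != 0 by rewrite -size_poly_gt0 sB0.
have g0 : g != 0 by rewrite gcdp_eq0 negb_and A00.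
have [A AE] : exists A, A0 = A * g by apply/dvdpP; exact: dvdp_gcdl.
have [B BE] : exists B, B0 = B * g by apply/dvdpP; exact: dvdp_gcdr.
have A_0 : A != 0 by apply: contraNneq A00 => e; rewrite AE e mul0r.
have B_0 : B != 0 by apply: contraNneq B00 => e; rewrite BE e mul0r.
have sAB : size A = (size B).+1.
  have := sA0; have := sB0; rewrite AE BE !size_mul //.
  have : (0 < size g)%N by rewrite size_poly_gt0.
  have : (0 < size B)%N by rewrite size_poly_gt0.
  have : (0 < size A)%N by rewrite size_poly_gt0.
  set a := size A; set b := size B; set c := size g; lia.
exists A, B, g; split=> //.
  have := @coprimep_div_gcd _ A0 B0; rewrite A00 /= => /(_ isT).
  by rewrite -/g {1}AE {1}BE !mulpK.
split=> //.
  have bB : (size B^`() < size B)%N by exact: lt_size_deriv.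
  have bA : (size A^`() < size A)%N by exact: lt_size_deriv.
  have h1 := size_polyMleq A^`() B; have h2 := size_polyMleq A B^`().
  have h3 := size_polyD (A^`() * B) (- (A * B^`())); rewrite size_polyN in h3.
  apply: leq_ltn_trans h3 _; rewrite gtn_max.
  have b_gt0 : (0 < size B)%N by rewrite size_poly_gt0.
  apply/andP; split.
    apply: leq_ltn_trans h1 _; move: bA sAB b_gt0.
    by set a := size A; set b := size B; set a' := size _; lia.
  apply: leq_ltn_trans h2 _; move: bB sAB b_gt0.
  by set a := size A; set b := size B; set a' := size _^`(); lia.
pose W := A^`() * B - A * B^`().
pose P : {poly C} := mu0 *: (('X ^+ 3 - 'X) * W ^+ 2) - A * B * (A ^+ 2 - B ^+ 2).
have hE := (horner_exp, hornerM, hornerX, hornerD, hornerN, hornerZ, hornerC).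
suff P0 : P = 0.
  move=> x; have /(congr1 (horner^~ x)) := P0; rewrite horner0 /P /W !hE => /eqP.
  by rewrite subr_eq0 => /eqP <-; ring.
apply: (poly_eq0_generic g0) => x gx.
have W0E : A0^`() * B0 - A0 * B0^`() = g ^+ 2 * W.
  by rewrite AE BE /W !derivM; ring.
have W0x : (A0^`() * B0 - A0 * B0^`()).[x] = n.[x ^+ 2] * d.[x ^+ 2] +
   2 * x ^+ 2 * (n^`().[x ^+ 2] * d.[x ^+ 2] - n.[x ^+ 2] * d^`().[x ^+ 2]).
  rewrite /A0 /B0 !derivM derivX !deriv_comp derivXn /=.
  rewrite !(horner_comp, hE, hornerXn, hornerMn).
  by rewrite -mulr_natl; ring.
have A0x : A0.[x] = x * n.[x ^+ 2] by rewrite /A0 hornerM hornerX horner_comp hornerXn.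
have B0x : B0.[x] = d.[x ^+ 2] by rewrite /B0 horner_comp hornerXn.
apply: (mulfI (expf_neq0 4 gx)); rewrite mulr0 /P !hE.
transitivity (mu0 * (x ^+ 3 - x) * ((g ^+ 2 * W).[x]) ^+ 2
   - (A * g).[x] * (B * g).[x] * ((A * g).[x] ^+ 2 - (B * g).[x] ^+ 2)).
  by rewrite !hE; ring.
rewrite -W0E -AE -BE W0x A0x B0x.
transitivity (x * (mu0 * (x ^+ 2 - 1) * (n.[x ^+ 2] * d.[x ^+ 2] +
     2 * x ^+ 2 * (n^`().[x ^+ 2] * d.[x ^+ 2] - n.[x ^+ 2] * d^`().[x ^+ 2])) ^+ 2
  - n.[x ^+ 2] * d.[x ^+ 2] * (x ^+ 2 * n.[x ^+ 2] ^+ 2 - d.[x ^+ 2] ^+ 2))).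
  by ring.
by rewrite rel subrr mulr0.
Qed.

Lemma isogeny_ex : exists phi : E1 C -> E1 C, nonzero_isogeny phi /\
  forall (P : E1 C) x y, E1val P = Aff x y -> d.[x ^+ 2] != 0 ->
    exists y', E1val (phi P) = Aff (x * (n.[x ^+ 2] / d.[x ^+ 2])) y'.
Proof.
have [A [B [g [AE BE B0 cAB [sAB sW ode]]]]] := lowest_terms.
pose c := sqrtC mu0; pose W := A^`() * B - A * B^`().
have ode' x : c ^+ 2 * (x ^+ 3 - x) * W.[x] ^+ 2
  = A.[x] * B.[x] * (A.[x] ^+ 2 - B.[x] ^+ 2) by rewrite sqrtCK ode.
exists (phi ode'); split; [split; [split|]|].
- exact: algebraic_phi B0 cAB sAB ode' sW.
- exact: phi_morph B0 cAB sAB ode'.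
- have /closed_nonrootP[x Bx] := B0.
  have on : onE1 (Aff x (sqrtC (x ^+ 3 - x))) by rewrite /= sqrtCK.
  exists (MkE1 on); move/(congr1 (@E1val C)); rewrite /= ifN //.
move=> P x y Pxy dx.
have Bg : B.[x] * g.[x] = d.[x ^+ 2].
  by rewrite -hornerM -BE horner_comp hornerXn.
have Ag : A.[x] * g.[x] = x * n.[x ^+ 2].
  by rewrite -hornerM -AE hornerM hornerX horner_comp hornerXn.
have /andP[Bx gx] : (B.[x] != 0) && (g.[x] != 0) by rewrite -negb_or -mulf_eq0 Bg.
exists (image_y B W c x y); rewrite /= Pxy /= (negPf Bx); congr Aff.
by rewrite mulrA -Ag -Bg /image_x; field; rewrite Bx gx.
Qed.

End Isogeny.

(** * Convergence of the hypergeometric series *)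

Section CoefficientBounds.
Variable C : numClosedFieldType.

Lemma binom_coef_bound k : 0 <= binom_coef C k <= 1.
Proof.
elim: k => [|k /andP[b0 b1]]; first by rewrite binom_coef0 ler01 lexx.
have k0 : 0 < 2 * k.+1%:R :> C by rewrite mulr_gt0 ?ltr0n.
have -> : binom_coef C k.+1 = (2 * k%:R + 1) / (2 * k.+1%:R) * binom_coef C k.
  have d0 := lt0r_neq0 k0; apply: (mulfI d0); rewrite binom_coefS.
  by move: (2 * k.+1%:R) d0 => d d0; field.
have q0 : 0 <= (2 * k%:R + 1) / (2 * k.+1%:R) :> C.
  by rewrite divr_ge0 ?(ltW k0) // addr_ge0 ?mulr_ge0 ?ler0n.
rewrite mulr_ge0 //= mulr_ile1 // ler_pdivrMr // mul1r.
have -> : 2 * k.+1%:R = (2 * k%:R + 1) + 1 :> C by rewrite -[k.+1%:R]natr1; ring.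
by rewrite lerDl ler01.
Qed.

Lemma hyp_coef_le1 k : `|hyp_coef C k| <= 1.
Proof.
have k0 : 1 <= 4 * k%:R + 1 :> C by rewrite lerDr mulr_ge0 ?ler0n.
have /andP[b0 b1] := binom_coef_bound k.
have kp := lt_le_trans ltr01 k0.
have -> : hyp_coef C k = binom_coef C k / (4 * k%:R + 1).
  by rewrite -hyp_coefE mulrAC divff ?mul1r // lt0r_neq0.
rewrite ger0_norm; last by rewrite divr_ge0 // ltW.
rewrite ler_pdivrMr // mul1r.
exact: le_trans k0.
Qed.

End CoefficientBounds.

Section ComplexSeries.
Variable R : realType.
Local Notation C := R[i].
Local Notation Re := (@complex.Re R).
Local Notation Im := (@complex.Im R).
Local Notation rc := (@real_complex R).

Lemma ReD (a b : C) : Re (a + b) = Re a + Re b.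
Proof. by case: a; case: b. Qed.

Lemma ImD (a b : C) : Im (a + b) = Im a + Im b.
Proof. by case: a; case: b. Qed.

Lemma cvg_real_complex (f : nat -> R) (l : R) :
  f n @[n --> \oo] --> l -> rc (f n) @[n --> \oo] --> (rc l : C).
Proof.
move=> /cvgrPdist_lt h; apply/cvgrPdist_lt => e e0.
have eE : rc (Re e) = e by apply: RRe_real; exact: gtr0_real.
have : 0 < Re e by rewrite -(@ltcR R) eE.
move=> /h; apply: filterS => n hn.
by rewrite -rmorphB /= normc_def /= expr0n addr0 sqrtr_sqr -eE ltcR.
Qed.

Lemma normc_ge_Im (x : C) : rc `|Im x| <= `|x|.
Proof.
by rewrite normc_def lecR -sqrtr_sqr ler_wsqrtr // lerDr sqr_ge0.
Qed.

Lemma cvg_complex_series (u : nat -> C) (v : nat -> R) :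
  (forall k, `|u k| <= rc (v k)) -> cvgn (series v) -> cvgn (series u).
Proof.
move=> uv cv.
have v0 k : 0 <= v k by rewrite -(@lecR R) (le_trans _ (uv k)) // rmorph0.
have part (g : C -> R) : (forall x, rc `|g x| <= `|x|) -> cvgn (series (g \o u)).
  move=> gn; apply: normed_cvg; apply: series_le_cvg cv => //= k.
  by rewrite -(@lecR R) (le_trans (gn _)).
have /cvg_ex[a ca] := part Re (@normc_ge_Re R).
have /cvg_ex[b cb] := part Im normc_ge_Im.
apply/cvg_ex; exists (rc a + 'i%C * rc b).
have rS n : Re (series u n) = series (Re \o u) n.
  rewrite /series /=; elim: n => [|n ih]; first by rewrite !big_geq.
  by rewrite !big_nat_recr //= ReD ih.
have iS n : Im (series u n) = series (Im \o u) n.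
  rewrite /series /=; elim: n => [|n ih]; first by rewrite !big_geq.
  by rewrite !big_nat_recr //= ImD ih.
have -> : series u = (fun n => rc (series (Re \o u) n) + 'i%C * rc (series (Im \o u) n)).
  apply/funext => n; rewrite -rS -iS; case: (series u n) => x y.
  by apply/eqP; rewrite eq_complex /= !(mul0r, mul1r, mulr0, addr0, add0r, subr0) !eqxx.
apply: cvgD; first exact: cvg_real_complex.
apply: cvgM; [exact: cvg_cst|exact: cvg_real_complex].
Qed.

Lemma hyp2F1_tail (z : C) n : `|z| <= 1 / 2 ->
  `|hyp2F1 (1 / 2) (1 / 4) (5 / 4) z - (hyp_poly C n).[z]| <= 2 * `|z| ^+ n.+1.
Proof.
move=> z2; pose u := hyp2F1_term (1 / 2) (1 / 4) (5 / 4) z.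
have uE k : u k = hyp_coef C k * z ^+ k by [].
have ub k : `|u k| <= `|z| ^+ k.
  by rewrite uE normrM normrX ler_piMl ?exprn_ge0 // hyp_coef_le1.
have zE : rc (Re `|z|) = `|z| by apply: RRe_real; exact: normr_real.
have cu : cvgn (series u).
  apply: (@cvg_complex_series _ (geometric 1 (Re `|z|))).
    by move=> k; rewrite /= mul1r rmorphXn /= zE.
  apply: is_cvg_geometric_series; rewrite ger0_norm; last first.
    by rewrite -(@lecR R) zE rmorph0.
  rewrite -(@ltcR R) zE rmorph1 (le_lt_trans z2) //.
  by rewrite ltr_pdivrMr ?ltr0n // mul1r ltr1n.
have sn : (hyp_poly C n).[z] = series u n.+1.
  by rewrite horner_poly /series /= big_mkord.
have part N : (n < N)%N -> `|series u N - series u n.+1| <= 2 * `|z| ^+ n.+1 - 2 * `|z| ^+ N.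
  elim: N => // N ih; rewrite ltnS leq_eqVlt => /orP[/eqP <-|lt].
    by rewrite !subrr normr0.
  rewrite {1}/series /= big_nat_recr //= -/(series u N) addrAC.
  apply: le_trans (ler_normD _ _) _; apply: le_trans (lerD (ih lt) (ub N)) _.
  rewrite [_ ^+ N.+1]exprS -addrA lerD2l -subr_ge0.
  rewrite [X in 0 <= X](_ : _ = (1 - 2 * `|z|) * `|z| ^+ N); last by ring.
  by rewrite mulr_ge0 ?exprn_ge0 // subr_ge0 mulrC -ler_pdivlMr ?ltr0n.
rewrite sn; apply/ler_addgt0Pr => e e0.
have /cvgrPdist_le/(_ e e0) : series u N @[N --> \oo] --> limn (series u) by [].
move=> [N _ hN]; pose M := maxn N n.+1.
have hM : `|limn (series u) - series u M| <= e by apply: hN => /=; exact: leq_maxl.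
have -> : hyp2F1 (1 / 2) (1 / 4) (5 / 4) z - series u n.+1
   = (series u M - series u n.+1) + (limn (series u) - series u M).
  by rewrite [RHS]addrC addrA subrK.
apply: le_trans (ler_normD _ _) _; apply: lerD => //.
apply: le_trans (part _ _) _; first exact: leq_maxr.
by rewrite gerBl mulr_ge0 ?ler0n ?exprn_ge0.
Qed.

End ComplexSeries.

Theorem theorem2p2 (R : realType) (mu : {fraction {poly R[i]}}) (mu0 : R[i])
    (mu_lim : ratval mu s @[s --> cinfty] --> mu0)
    (mu0_neq0 : mu0 != 0)
    (identity : \forall z \near (0 : R[i])^',
       hyp2F1 (1 / 2) (1 / 4) (5 / 4) z =
       powNhalf (ratval mu z^-1 / mu0) *
       hyp2F1 (1 / 2) (1 / 4) (5 / 4) (z / ratval mu z^-1 ^+ 2)) :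
  exists phi : E1 R[i] -> E1 R[i],
    nonzero_isogeny phi /\ transforms_x_by mu phi.
Proof.
(* Squared, the identity does not depend on the branch of the power. *)
have squared : \forall z \near (0 : R[i])^', ratval mu z^-1 != 0 ->
    hyp2F1 (1 / 2) (1 / 4) (5 / 4) z ^+ 2 * ratval mu z^-1 =
    mu0 * hyp2F1 (1 / 2) (1 / 4) (5 / 4) (z / ratval mu z^-1 ^+ 2) ^+ 2.
  apply: filterS identity => z -> r0.
  rewrite exprMn /powNhalf exprVn sqr_sqrtc.
  by field; rewrite r0 mu0_neq0.
have [m [sn sd rel]] :=
  algebraic_identity mu0_neq0 (ratden_neq0 mu) mu_lim (@hyp2F1_tail R) squared.
exact: (isogeny_ex sn sd rel).
Qed.
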